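(* Let $a$, $b$, $a'$, $b'$, and $m$ be integers with $1 \leq a < b \leq m$ and $1 \leq a' < b' \leq m$. Suppose that $b - a = b' - a' > 1$ and that $a + b < a' + b' \leq m+1$. Then for all sufficiently large $n$ we have \[e(P_n^{m, a, b}) < e(P_n^{m, a', b'}).\]
   Context: For a finite poset $P$, $e(P)$ denotes the number of linear extensions of $P$. For integers $1 \le a < b \le m$ and $n \ge 1$, the cluster poset $P_n^{m,a,b}$ is obtained by gluing together $n$ chains of length $m$: its elements are $A_{i,j}$ for $1 \le i \le n$ and $1 \le j \le m$, where $A_{i,b} = A_{i+1,a}$ for $1 \le i \le n-1$ and the $A_{i,j}$ are distinct otherwise (so there are $(m-1)n+1$ elements in total); its relations are generated by $A_{i,1} \le A_{i,2} \le \cdots \le A_{i,m}$ for $1 \le i \le n$. *)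

(* Defs.v *)
From HB Require Import structures.
From mathcomp Require Import all_boot all_order.

Set Implicit Arguments.
Unset Strict Implicit.
Unset Printing Implicit Defensive.

Definition linear_extension (d : Order.disp_t) (P : finPOrderType d)
    (f : {ffun P -> 'I_#|P|}) : bool :=
  injectiveb f && [forall x : P, forall y : P, (x <= y)%O ==> (f x <= f y)].

Definition num_linear_extensions (d : Order.disp_t) (P : finPOrderType d) : nat :=
  #|[set f : {ffun P -> 'I_#|P|} | linear_extension f]|.

(* Ordinals start at 0: the pair (i, j) is the element j + 1 of chain i + 1,
   i.e. A_{i+1, j+1}. *)
Notation chain_pt n m := ('I_n * 'I_m)%type.

(* p = A_{i,b} and q = A_{i+1,a} for some i *)
Definition glue (n m a b : nat) : rel (chain_pt n m) :=
  fun p q => [&& p.2.+1 == b, q.1 == p.1.+1 :> nat & q.2.+1 == a].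

Definition glue_sym (n m a b : nat) : rel (chain_pt n m) :=
  fun p q => glue a b p q || glue a b q p.

Definition glued (n m a b : nat) : rel (chain_pt n m) :=
  connect (@glue_sym n m a b).

Lemma glued_refl n m a b : reflexive (@glued n m a b).
Proof. by move=> p; apply: connect0. Qed.

Lemma glued_sym n m a b : symmetric (@glued n m a b).
Proof. by apply: sym_connect_sym => p q; rewrite /glue_sym orbC. Qed.

Lemma glued_trans n m a b : transitive (@glued n m a b).
Proof. exact: connect_trans. Qed.

Canonical glued_equiv (n m a b : nat) :=
  EquivRel (@glued n m a b) (@glued_refl n m a b) (@glued_sym n m a b)
           (@glued_trans n m a b).

(* The carrier of P_n^{m,a,b} *)
Definition cluster (n m a b : nat) : Type :=
  {eq_quot @glued_equiv n m a b}%qT.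
HB.instance Definition _ (n m a b : nat) := Quotient.on (cluster n m a b).
HB.instance Definition _ (n m a b : nat) :=
  [Finite of cluster n m a b by <:%/].

Definition clusterA (n m a b : nat) (i : 'I_n) (j : 'I_m) : cluster n m a b :=
  (\pi_(cluster n m a b) ((i, j) : chain_pt n m))%qT.

Definition cluster_step (n m a b : nat) : rel (cluster n m a b) :=
  fun x y => [exists i : 'I_n, exists j : 'I_m, exists k : 'I_m,
    [&& k == j.+1 :> nat, x == clusterA a b i j & y == clusterA a b i k]].

Definition cluster_le (n m a b : nat) : rel (cluster n m a b) :=
  connect (@cluster_step n m a b).

(* i * (b - a) + j up to a constant, written without subtracting a from b:
   constant on glued points and strictly increasing along the chains. *)
Definition cluster_rank (n m a b : nat) (p : chain_pt n m) : nat :=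
  p.1 * b + (n - p.1) * a + p.2.

Lemma glued_rank n m a b (p q : chain_pt n m) :
  glued a b p q -> cluster_rank a b p = cluster_rank a b q.
Proof.
have H (x y : chain_pt n m) :
    glue a b x y -> cluster_rank a b x = cluster_rank a b y.
  case: x y => [i j] [i' j'] /and3P[/= /eqP <- /eqP ei /eqP <-].
  rewrite /cluster_rank /= ei -(subnSK (_ : i < n)%N) // !mulSn.
  by rewrite !addSn addnS addSn addnA [in RHS](ACl (2 * 4 * 3 * 1)).
case/connectP=> s; elim: s p => [|r s IHs] p /=; first by move=> _ ->.
case/andP=> pr /IHs{}IHs /IHs <-.
by case/orP: pr => /H.
Qed.

Lemma cluster_le_refl n m a b : reflexive (@cluster_le n m a b).
Proof. by move=> x; apply: connect0. Qed.

Lemma cluster_le_trans n m a b : transitive (@cluster_le n m a b).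
Proof. exact: connect_trans. Qed.

Lemma cluster_le_rank n m a b (x y : cluster n m a b) :
  cluster_le x y ->
  x = y \/ (cluster_rank a b (repr x) < cluster_rank a b (repr y))%N.
Proof.
have rank_pi (p : chain_pt n m) :
    cluster_rank a b (repr (\pi_(cluster n m a b) p)%qT) = cluster_rank a b p.
  by apply: glued_rank; apply/(eqmodP (@glued_equiv n m a b)); rewrite reprK.
case/connectP=> s; elim: s x => [|z s IHs] x /=; first by move=> _ ->; left.
case/andP=> /existsP[i /existsP[j /existsP[k]]].
case/and3P=> /eqP ek /eqP -> /eqP ez /IHs{}IHs /IHs{}IHs; right.
have lt_z : (cluster_rank a b (repr (clusterA a b i j)) <
             cluster_rank a b (repr z))%N.
  by rewrite ez !rank_pi /cluster_rank /= ek addnS.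
by case: IHs => [<- // | ]; apply: ltn_trans.
Qed.

Lemma cluster_le_anti n m a b : antisymmetric (@cluster_le n m a b).
Proof.
move=> x y /andP[/cluster_le_rank[//|lt_xy] /cluster_le_rank[//|lt_yx]].
by have := ltn_trans lt_xy lt_yx; rewrite ltnn.
Qed.

Fact cluster_display : Order.disp_t. Proof. exact: Order.Disp tt tt. Qed.

HB.instance Definition _ (n m a b : nat) :=
  Order.Le_isPOrder.Build cluster_display (cluster n m a b)
    (@cluster_le_refl n m a b) (@cluster_le_anti n m a b)
    (@cluster_le_trans n m a b).

(* Main.v *)
Require Import Defs.
From mathcomp Require Import all_boot all_order all_fingroup all_algebra.
From mathcomp Require Import zify ring lra.
From mathcomp Require Import generic_quotient.

Set Implicit Arguments.
Unset Strict Implicit.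
Unset Printing Implicit Defensive.

(** Put [p = a - 1], [c = b - a] and [q = m - b]. The cluster poset consists of a
    chain of [c * n + 1] elements, its spine, on which each of the [n] glued
    chains hangs a chain of [p] elements below the spine element [c * i] and one
    of [q] elements above the spine element [c * (i + 1)]. The two posets have
    the same [c] and the same [p + q], hence the same number [N] of elements, but
    [p < p' <= q' < q]: the second one is more balanced.

    Linear extensions are counted through order-preserving maps to a chain with
    [M + 1] elements, where [M = 4 * N ^ 2]. The number of extensions times a
    binomial coefficient is at most the number of strict maps
    ([num_linear_extensions_le_strict]), and it is at least the number of weak
    maps for a slightly larger binomial coefficient
    ([weak_le_num_linear_extensions]); the two coefficients differ by a factor at
    most 2. Once the values [x] on the spine are given, the side chains can be
    filled independently, which gives a product of binomial coefficients
    ([card_strict_rows], [card_weak_rows]), with upper index near [x] for the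
    lower chains and near [M - x] for the upper ones.

    These binomial coefficients are compared with the powers [phi p x ^+ c],
    where [phi p x] grows like [x] to the power [p / c]. Up to a polynomial in
    [M], the power [c] at every [c]-th spine element can be spread evenly over
    the whole spine, because [V v = phi p v * phi q (M - v)] is unimodal
    ([unimodal_spine_prod]). The sum over all spines is then essentially the
    power [c * n + 1] of the sum of [V], divided by [(c * n + 1)!]. By Vandermonde's
    identity this sum is [phi (p + q + c) M] ([sum_phi]), the same for both
    posets.

    So the exponential growth rates differ only through the constants that
    relate [phi p x ^+ c] to the binomial coefficients. The constant for the
    balanced pair [p', q'] is strictly better when [c > 1] ([alpha_beta_gap]); the
    resulting exponential in [n] outgrows all the polynomial losses. *)

(** * Ranks and sorting in finite sets *)

Section Rank.

Variable T : finType.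

Lemma rank_subproof (key : T -> nat) (x : T) :
  #|[set y | key y < key x]| < #|T|.
Proof.
rewrite -[#|T|]cardsT; apply: proper_card; apply/properP; split.
  by apply/subsetP => y; rewrite inE.
by exists x; rewrite !inE ?ltnn.
Qed.

Definition rank (key : T -> nat) (x : T) : 'I_#|T| :=
  Ordinal (rank_subproof key x).

Lemma rank_lt (key : T -> nat) x y : key x < key y -> rank key x < rank key y.
Proof.
move=> lt_xy; apply: proper_card; apply/properP; split.
  by apply/subsetP => z; rewrite !inE => /ltn_trans; apply.
by exists x; rewrite !inE ?ltnn.
Qed.

(** Sorting by an injective key is how linear extensions and permutations are
    obtained below. *)
Lemma rank_inj (key : T -> nat) : injective key -> injective (rank key).
Proof.
move=> key_inj x y eq_xy; apply: key_inj.
have [||//] := ltngtP (key x) (key y) => /rank_lt; rewrite eq_xy ltnn //.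
Qed.

Lemma card_ord_lt N k : k <= N -> #|[set i : 'I_N | i < k]| = k.
Proof.
move=> le_kN.
have widen_inj : injective (widen_ord le_kN).
  by move=> i j /(congr1 val) /= /val_inj.
rewrite -[RHS]card_ord -(card_imset predT widen_inj).
apply: eq_card => i; rewrite inE; apply/idP/imsetP => [lt_ik | [j _ ->]]; last first.
  exact: ltn_ord j.
by exists (Ordinal lt_ik) => //; apply: val_inj.
Qed.

(** This recovers a numbering of [T] from any map that orders [T] in the same
    way. *)
Lemma rank_id (f : T -> 'I_#|T|) x :
  injective f -> #|[set y | f y < f x]| = f x.
Proof.
move=> f_inj; rewrite -[RHS](card_ord_lt (ltnW (ltn_ord (f x)))).
rewrite -(card_imset _ f_inj); apply: eq_card => i; rewrite inE.
have f_bij : bijective f by apply: inj_card_bij; rewrite ?card_ord.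
case: f_bij => g fK gK; apply/imsetP/idP => [[y]|lt_i]; first by rewrite inE => ? ->.
by exists (g i); rewrite ?inE gK.
Qed.

End Rank.

Lemma lex_lt B a b e e' : a < b -> e < B -> a * B + e < b * B + e'.
Proof.
move=> lt_ab lt_eB; apply: leq_trans (leq_addr _ _).
by apply: (@leq_trans (a.+1 * B)); rewrite ?leq_mul2r ?lt_ab ?orbT // mulSn; lia.
Qed.

(** * Linear extensions and order-preserving maps to a chain *)

Definition strict_maps (d : Order.disp_t) (P : finPOrderType d) (M : nat)
    : {set {ffun P -> 'I_M}} :=
  [set g : {ffun P -> 'I_M} | [forall x, forall y, (x < y)%O ==> (g x < g y)]].

Definition weak_maps (d : Order.disp_t) (P : finPOrderType d) (M : nat)
    : {set {ffun P -> 'I_M}} :=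
  [set g : {ffun P -> 'I_M} | [forall x, forall y, (x <= y)%O ==> (g x <= g y)]].

Section MapsToChains.

Variables (d : Order.disp_t) (P : finPOrderType d).

Lemma strict_mapsP M (g : {ffun P -> 'I_M}) :
  reflect (forall x y, (x < y)%O -> g x < g y) (g \in strict_maps P M).
Proof.
rewrite inE; apply: (iffP forallP) => [H x y | H x].
  by move: x (H x) => x /forallP/(_ y)/implyP.
by apply/forallP => y; apply/implyP; apply: H.
Qed.

Lemma weak_mapsP M (g : {ffun P -> 'I_M}) :
  reflect (forall x y, (x <= y)%O -> g x <= g y) (g \in weak_maps P M).
Proof.
rewrite inE; apply: (iffP forallP) => [H x y | H x].
  by move: x (H x) => x /forallP/(_ y)/implyP.
by apply/forallP => y; apply/implyP; apply: H.
Qed.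

Lemma linear_extensionP (f : {ffun P -> 'I_#|P|}) :
  reflect (injective f /\ forall x y, (x <= y)%O -> f x <= f y)
          (linear_extension f).
Proof.
apply: (iffP andP) => -[f_inj H]; split; first exact/injectiveP.
- by move=> x y; move: H => /forallP/(_ x)/forallP/(_ y)/implyP.
- exact/injectiveP.
by apply/forallP => x; apply/forallP => y; apply/implyP; apply: H.
Qed.

End MapsToChains.

Lemma strict_maps_ordP k M (g : {ffun 'I_k -> 'I_M}) :
  reflect (forall i j : 'I_k, i < j -> g i < g j) (g \in strict_maps 'I_k M).
Proof. exact: strict_mapsP. Qed.

Lemma weak_maps_ordP k M (g : {ffun 'I_k -> 'I_M}) :
  reflect (forall i j : 'I_k, i <= j -> g i <= g j) (g \in weak_maps 'I_k M).
Proof. exact: weak_mapsP. Qed.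

Lemma card_strict_maps_ord k M : #|strict_maps 'I_k M| = 'C(M, k).
Proof.
rewrite -card_ltn_sorted_tuples.
pose f (h : {ffun 'I_k -> 'I_M}) := [tuple h i | i < k].
pose g (t : k.-tuple 'I_M) := [ffun i => tnth t i].
have fK : cancel f g by move=> h; apply/ffunP => i; rewrite ffunE tnth_mktuple.
have gK : cancel g f.
  by move=> t; apply: eq_from_tnth => i; rewrite tnth_mktuple ffunE.
rewrite -(card_imset _ (can_inj fK)); apply: eq_card => t.
rewrite -[t in LHS]gK mem_imset; last exact: can_inj fK.
rewrite [in RHS]inE; apply/strict_maps_ordP/idP => [t_lt | t_sorted].
  apply/(sortedP 0) => i; rewrite size_map size_tuple => lt_i.
  have lt_i' := ltnW lt_i.
  have := t_lt (Ordinal lt_i') (Ordinal lt_i) (ltnSn i); rewrite !ffunE.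
  have x0 : 'I_M := tnth t (Ordinal lt_i).
  by rewrite !(tnth_nth x0) /= !(nth_map x0) ?size_tuple.
move=> i j lt_ij; have x0 : 'I_M := tnth t i; rewrite !ffunE !(tnth_nth x0).
have := sorted_ltn_nth ltn_trans 0 t_sorted (i) (j).
rewrite !inE !size_map size_tuple !ltn_ord => /(_ isT isT lt_ij).
by rewrite !(nth_map x0) ?size_tuple.
Qed.

Lemma card_weak_maps_ord k M : #|weak_maps 'I_k M.+1| = 'C(M + k, k).
Proof.
rewrite addnC -card_sorted_tuples.
pose f (h : {ffun 'I_k -> 'I_M.+1}) := [tuple h i | i < k].
pose g (t : k.-tuple 'I_M.+1) := [ffun i => tnth t i].
have fK : cancel f g by move=> h; apply/ffunP => i; rewrite ffunE tnth_mktuple.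
have gK : cancel g f.
  by move=> t; apply: eq_from_tnth => i; rewrite tnth_mktuple ffunE.
rewrite -(card_imset _ (can_inj fK)); apply: eq_card => t.
rewrite -[t in LHS]gK mem_imset; last exact: can_inj fK.
rewrite [in RHS]inE; apply/weak_maps_ordP/idP => [t_lt | t_sorted].
  apply/(sortedP 0) => i; rewrite size_map size_tuple => lt_i.
  have lt_i' := ltnW lt_i.
  have := t_lt (Ordinal lt_i') (Ordinal lt_i) (leqnSn i); rewrite !ffunE.
  rewrite !(tnth_nth ord0) /=.
  by rewrite !(nth_map ord0) ?size_tuple.
move=> i j lt_ij; rewrite !ffunE !(tnth_nth ord0).
have := sorted_leq_nth leq_trans leqnn 0 t_sorted (i) (j).
rewrite !inE !size_map size_tuple !ltn_ord => /(_ isT isT lt_ij).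
by rewrite !(nth_map ord0) ?size_tuple.
Qed.

Section Sandwich.

Variables (d : Order.disp_t) (P : finPOrderType d).

Let numbering_onto (f : {ffun P -> 'I_#|P|}) :
  injective f -> forall k, k \in codom f.
Proof. by move=> f_inj; apply: inj_card_onto => //; rewrite card_ord. Qed.

(** Relabelling a linear extension by an increasing map of its values gives a
    strict map, and a strict map that arises so determines the extension (as
    its rank function) and then the relabelling. *)
Lemma num_linear_extensions_le_strict M :
  num_linear_extensions P * 'C(M, #|P|) <= #|strict_maps P M|.
Proof.
rewrite -card_strict_maps_ord /num_linear_extensions.
set LE := [set f | _]; set S := strict_maps 'I_#|P| M.
pose F (u : {ffun P -> 'I_#|P|} * {ffun 'I_#|P| -> 'I_M}) :=
  [ffun x => u.2 (u.1 x)].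
rewrite -cardsX -(@card_in_imset _ _ F); last first.
  case=> f h [f' h']; rewrite !in_setX /=.
  move=> /andP[fLE /strict_maps_ordP h_lt] /andP[f'LE /strict_maps_ordP h'_lt].
  move: fLE f'LE; rewrite !inE => /linear_extensionP[f_inj _].
  case/linear_extensionP=> f'_inj _.
  have hE (k : {ffun 'I_#|P| -> 'I_M}) :
      (forall i j : 'I_#|P|, i < j -> k i < k j) ->
      forall i j, (k i < k j) = (i < j).
    move=> k_lt i j; apply/idP/idP; last exact: k_lt.
    by case: (ltngtP i j) => // [/k_lt|/val_inj->]; lia.
  move/ffunP => eqF; have eqf : f = f'.
    apply/ffunP => x; apply: val_inj => /=.
    rewrite -(rank_id x f_inj) -(rank_id x f'_inj); apply: eq_card => y.
    rewrite !inE -(hE _ h_lt) -(hE _ h'_lt).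
    by have := eqF x; have := eqF y; rewrite !ffunE /= => -> ->.
  rewrite eqf; congr pair; apply/ffunP => k.
  have /codomP[x ->] := numbering_onto f'_inj k.
  by have := eqF x; rewrite !ffunE /= eqf.
apply: subset_leq_card; apply/subsetP => g /imsetP[[f h]].
rewrite in_setX => /andP[]; rewrite inE /= => /linear_extensionP[f_inj f_le].
move=> /strict_maps_ordP h_lt ->; apply/strict_mapsP => x y lt_xy.
rewrite !ffunE /=; apply: h_lt; rewrite ltn_neqAle f_le ?Order.POrderTheory.ltW //.
rewrite andbT; apply: contraTneq lt_xy => /val_inj /f_inj ->.
by rewrite Order.POrderTheory.ltxx.
Qed.

(** Sorting [P] by the value of a weak map, with ties broken by a fixed linear
    extension, gives a linear extension along which the map is weakly
    increasing. *)
Lemma weak_le_num_linear_extensions M :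
  #|weak_maps P M.+1| <= num_linear_extensions P * 'C(M + #|P|, #|P|).
Proof.
rewrite -card_weak_maps_ord /num_linear_extensions.
set LE := [set f | _]; set W := weak_maps 'I_#|P| M.+1.
pose down (x : P) := #|[set y | (y < x)%O]|.
have down_le x : down x <= #|P| by apply: max_card.
have down_lt x y : (x < y)%O -> down x < down y.
  move=> lt_xy; apply: proper_card; apply/properP; split.
    by apply/subsetP => z; rewrite !inE => /Order.POrderTheory.lt_trans; apply.
  by exists x; rewrite !inE ?Order.POrderTheory.ltxx.
pose key (g : {ffun P -> 'I_M.+1}) (x : P) :=
  (g x * #|P|.+1 + down x) * #|P| + enum_rank x.
have key_inj g : injective (key g).
  move=> x y; rewrite /key => eq_xy; apply: enum_rank_inj; apply: val_inj => /=.
  have := congr1 (modn^~ #|P|) eq_xy.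
  by rewrite /= !modnMDl !modn_small ?ltn_ord.
have key_val (g : {ffun P -> 'I_M.+1}) x y : g x < g y -> key g x < key g y.
  by move=> lt_g; apply: lex_lt; [apply: lex_lt; rewrite ?ltnS|].
have key_lt (g : {ffun P -> 'I_M.+1}) x y :
    g x <= g y -> (x < y)%O -> key g x < key g y.
  rewrite leq_eqVlt => /orP[/eqP eq_g /down_lt lt_xy | /key_val //].
  by rewrite /key eq_g; apply: lex_lt; rewrite ?ltn_add2l.
pose fl g := [ffun x => rank (key g) x].
have fl_inj g : injective (fl g).
  by move=> x y; rewrite !ffunE; apply: rank_inj.
pose flV g k := iinv (numbering_onto (@fl_inj g) k).
have flK g k : fl g (flV g k) = k by apply: f_iinv.
pose F g := (fl g, [ffun k => g (flV g k)]).
have FK g x : (F g).2 ((F g).1 x) = g x.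
  by rewrite /= [LHS]ffunE; congr (g _); apply: (fl_inj g); rewrite flK.
have F_inj : injective F.
  by move=> g g' eqF; apply/ffunP => x; rewrite -FK eqF FK.
rewrite -cardsX -(card_imset _ F_inj); apply: subset_leq_card.
apply/subsetP => _ /imsetP[g /weak_mapsP g_le ->].
rewrite in_setX /F /=; apply/andP; split.
  rewrite inE; apply/linear_extensionP; split=> // x y.
  rewrite Order.POrderTheory.le_eqVlt => /predU1P[-> // | lt_xy].
  rewrite !ffunE; apply/ltnW/rank_lt/key_lt => //.
  by apply/g_le/Order.POrderTheory.ltW.
apply/weak_maps_ordP => i j le_ij; rewrite !ffunE leqNgt.
apply: contraL le_ij => /key_val /rank_lt.
have E k : rank (key g) (flV g k) = k by have := flK g k; rewrite ffunE.
by rewrite !E -ltnNge.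
Qed.

End Sandwich.

(** * Sums over increasing sequences *)

Section IncreasingSums.

Import Order.TTheory GRing.Theory Num.Theory.
Local Open Scope ring_scope.

Variables (R : realFieldType) (M k : nat) (V : 'I_M -> R).
Hypothesis V_ge0 : forall v, 0 <= V v.

Let permute (u : {perm 'I_k} * {ffun 'I_k -> 'I_M}) : {ffun 'I_k -> 'I_M} :=
  [ffun i => u.2 (u.1 i)].

Let prod_permute u : \prod_i V (permute u i) = \prod_i V (u.2 i).
Proof.
rewrite [RHS](reindex_inj (@perm_inj _ u.1)) /=.
by apply: eq_bigr => i _; rewrite ffunE.
Qed.

Let sum_permuted (A : {set {ffun 'I_k -> 'I_M}}) :
  \sum_(u in setX [set: {perm 'I_k}] A) \prod_i V (permute u i) =
  k`!%:R * \sum_(x in A) \prod_i V (x i).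
Proof.
under eq_bigr do rewrite prod_permute.
transitivity (\sum_(s in [set: {perm 'I_k}]) \sum_(x in A) \prod_i V (x i)).
  rewrite pair_big /=; apply: eq_bigl => -[s x].
  by rewrite in_setX.
have card_k : #|[set: {perm 'I_k}]| = k`!.
  by rewrite cardsT card_Sn.
by rewrite sumr_const card_k mulr_natl.
Qed.

Let sum_all : (\sum_v V v) ^+ k = \sum_(x : {ffun 'I_k -> 'I_M}) \prod_i V (x i).
Proof.
by rewrite -(bigA_distr_bigA (fun _ => V)) /= prodr_const card_ord.
Qed.

(** Expanding the power gives all the sequences of [k] values; rearranging a
    strictly increasing one in the [k`!] ways gives distinct sequences. *)
Lemma sum_strict_maps_le :
  k`!%:R * \sum_(x in strict_maps 'I_k M) \prod_i V (x i) <= (\sum_v V v) ^+ k.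
Proof.
rewrite -sum_permuted sum_all.
rewrite -(@big_imset _ _ _ _ _ permute _ (fun y => \prod_i V (y i))) /=.
  rewrite [leRHS](bigID [in permute @: setX setT (strict_maps 'I_k M)]) /=.
  by rewrite lerDl sumr_ge0 // => x _; rewrite prodr_ge0.
case=> s x [t y]; rewrite !in_setX /= !in_setT /=.
move=> /strict_maps_ordP x_lt /strict_maps_ordP y_lt /ffunP eq_xy.
have xE (z : {ffun 'I_k -> 'I_M}) : (forall i j : 'I_k, (i < j)%N -> (z i < z j)%N) ->
    forall i j : 'I_k, (z i < z j)%N = (i < j)%N.
  move=> z_lt i j; apply/idP/idP; last exact: z_lt.
  by case: (ltngtP i j) => // [/z_lt|/val_inj->]; lia.
have perm_rank (r : {perm 'I_k}) i : #|[set j | (r j < r i)%N]| = r i.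
  pose r' (j : 'I_k) : 'I_#|'I_k| := cast_ord (esym (card_ord k)) (r j).
  by apply: (@rank_id _ r') => u v /cast_ord_inj/perm_inj.
have eq_st : s = t.
  apply/permP => i; apply: val_inj => /=; rewrite -(perm_rank s) -(perm_rank t).
  apply: eq_card => j; rewrite !inE -(xE _ x_lt) -(xE _ y_lt).
  by have := eq_xy i; have := eq_xy j; rewrite !ffunE /= => -> ->.
rewrite eq_st; congr pair; apply/ffunP => i.
by have := eq_xy ((t^-1)%g i); rewrite !ffunE /= eq_st permKV.
Qed.

(** Conversely every sequence is a rearrangement of a weakly increasing one. *)
Lemma sum_weak_maps_ge :
  (\sum_v V v) ^+ k <= k`!%:R * \sum_(x in weak_maps 'I_k M) \prod_i V (x i).
Proof.
rewrite -sum_permuted sum_all.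
rewrite [leRHS](partition_big permute xpredT) //=.
apply: ler_sum => y _.
pose key i := (y i * k + i)%N.
have key_inj : injective key.
  move=> i j /(congr1 (modn^~ k)); rewrite !modnMDl !modn_small //.
  exact: val_inj.
pose s0 i : 'I_k := cast_ord (card_ord k) (rank key i).
have s0_inj : injective s0 by move=> i j /cast_ord_inj /(rank_inj key_inj).
pose s := perm s0_inj.
have su : permute (s, [ffun i => y ((s^-1)%g i)]) = y.
  by apply/ffunP => i; rewrite !ffunE /= permK.
rewrite (bigD1 (s, [ffun i => y ((s^-1)%g i)])) /=.
  rewrite su lerDl sumr_ge0 // => u _.
  by rewrite prodr_ge0.
rewrite su eqxx andbT in_setX inE /=; apply/weak_maps_ordP => i j le_ij.
rewrite !ffunE leqNgt; apply: contraL le_ij => lt_y.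
have s_lt u v : (y u < y v)%N -> (s u < s v)%N.
  by move=> lt_uv; rewrite !permE; apply: rank_lt; apply: lex_lt.
by have := s_lt _ _ lt_y; rewrite !permKV -ltnNge.
Qed.

End IncreasingSums.

Lemma strict_maps_succ k M (g : {ffun 'I_k -> 'I_M}) :
  (forall i j : 'I_k, j = i.+1 :> nat -> g i < g j) -> g \in strict_maps 'I_k M.
Proof.
move=> g_succ; apply/strict_maps_ordP => i j.
elim: {j}(val j) {-2}j (erefl (val j)) => [|r IHr] j ej; first by rewrite ej.
rewrite ej ltnS leq_eqVlt => /predU1P[ir | lt_ir]; first by apply: g_succ; rewrite ej ir.
have lt_rk : r < k by apply: ltnW; rewrite -ej; apply: ltn_ord.
by apply: ltn_trans (IHr (Ordinal lt_rk) (erefl _) lt_ir) (g_succ _ _ _).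
Qed.

Lemma weak_maps_succ k M (g : {ffun 'I_k -> 'I_M}) :
  (forall i j : 'I_k, j = i.+1 :> nat -> g i <= g j) -> g \in weak_maps 'I_k M.
Proof.
move=> g_succ; apply/weak_maps_ordP => i j.
elim: {j}(val j) {-2}j (erefl (val j)) => [|r IHr] j ej.
  rewrite ej leqn0 => /eqP i0; suff -> : i = j by [].
  by apply: val_inj; rewrite /= i0.
rewrite ej leq_eqVlt => /predU1P[ir | lt_ir].
  by suff -> : i = j by []; apply: val_inj; rewrite /= ir.
have lt_rk : r < k by apply: ltnW; rewrite -ej; apply: ltn_ord.
by apply: leq_trans (IHr (Ordinal lt_rk) (erefl _) lt_ir) (g_succ _ _ _).
Qed.

(** A strict map of a chain is determined by its set of values, its entry number
    [i] being the value that exceeds exactly [i] others. *)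
Lemma card_strict_maps_in k M (B : {set 'I_M}) :
  #|[set g in strict_maps 'I_k M | [forall i, g i \in B]]| <= 'C(#|B|, k).
Proof.
rewrite -cards_draws; pose im (g : {ffun 'I_k -> 'I_M}) := g @: [set: 'I_k].
have sg_inj (g : {ffun 'I_k -> 'I_M}) : g \in strict_maps 'I_k M -> injective g.
  move=> /strict_maps_ordP g_lt i j eq_g; apply: val_inj.
  by case: (ltngtP i j) => // /g_lt; rewrite eq_g ltnn.
have im_rank g i : g \in strict_maps 'I_k M -> #|[set v in im g | v < g i]| = i.
  move=> gS; have g_lt := strict_maps_ordP _ gS.
  rewrite -[RHS](card_ord_lt (ltnW (ltn_ord i))) -(card_imset _ (sg_inj _ gS)).
  apply: eq_card => v; rewrite inE.
  apply/andP/imsetP => [[/imsetP[j _ ->] lt_j] | [j]].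
    exists j => //; rewrite inE ltnNge; apply: contraL lt_j.
    rewrite leq_eqVlt -leqNgt => /predU1P[/val_inj-> // | /g_lt /ltnW //].
  by rewrite inE => /g_lt lt_j ->; split=> //; apply: imset_f.
rewrite -(@card_in_imset _ _ im) => [|g g'].
  apply: subset_leq_card; apply/subsetP => _ /imsetP[g + ->].
  rewrite !inE => /andP[gS /forallP gB]; apply/andP; split.
    by apply/subsetP => _ /imsetP[i _ ->].
  by rewrite card_imset ?cardsT ?card_ord //; apply: sg_inj; rewrite inE.
rewrite !inE => /andP[gS _] /andP[g'S _] eq_im; apply/ffunP => i.
have : g i \in im g' by rewrite -eq_im imset_f.
case/imsetP=> j _ eq_ij; rewrite eq_ij; congr (g' _); apply: val_inj => /=.
rewrite -(@im_rank g' j) ?inE // -(@im_rank g i) ?inE //.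
by apply: eq_card => v; rewrite !inE eq_im eq_ij.
Qed.

Lemma card_ord_gt M (z : 'I_M.+1) : #|[set v : 'I_M.+1 | z < v]| = M - z.
Proof.
have /= := cardsC [set v : 'I_M.+1 | v < z.+1].
rewrite card_ord_lt ?ltn_ord // card_ord => E.
suff -> : [set v : 'I_M.+1 | z < v] = ~: [set v : 'I_M.+1 | v < z.+1] by lia.
by apply/setP => v; rewrite !inE ltnS -ltnNge.
Qed.

(** * The cluster poset as a spine with side chains *)

Section Cluster.

Variables n p c q : nat.
Hypothesis c_gt0 : 0 < c.

Local Notation m := (p + c + q).+1.
Local Notation a := p.+1.
Local Notation b := (p + c).+1.
Local Notation K := (c * n.+1).+1.
Local Notation poset := (cluster n.+1 m a b).

Local Notation at_ i j := (@clusterA n.+1 m a b i j).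

Lemma clusterA_glue (i j : 'I_n.+1) (k l : 'I_m) :
  j = i.+1 :> nat -> k = (p + c)%N :> nat -> l = p :> nat -> at_ i k = at_ j l.
Proof.
move=> ej ek el; apply/(eqmodP (@glued_equiv n.+1 m a b))/connect1.
by rewrite /glue_sym /glue /= ek el ej !eqxx.
Qed.

Lemma cluster_rankA (i : 'I_n.+1) (j : 'I_m) :
  cluster_rank a b (repr (at_ i j)) = cluster_rank a b (i, j).
Proof.
by apply: glued_rank; apply/(eqmodP (@glued_equiv n.+1 m a b)); rewrite reprK.
Qed.

Lemma clusterA_le (i : 'I_n.+1) (j k : 'I_m) :
  k = j.+1 :> nat -> (at_ i j <= at_ i k)%O.
Proof.
move=> ek; apply: connect1; apply/existsP; exists i; apply/existsP; exists j.
by apply/existsP; exists k; rewrite ek !eqxx.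
Qed.

Lemma clusterA_lt (i : 'I_n.+1) (j k : 'I_m) :
  k = j.+1 :> nat -> (at_ i j < at_ i k)%O.
Proof.
move=> ek; rewrite Order.POrderTheory.lt_def clusterA_le // andbT.
apply/eqP => /(congr1 (fun u => cluster_rank a b (repr u))).
by rewrite !cluster_rankA /cluster_rank /= ek; lia.
Qed.

Section Rows.

Variable M : nat.
Local Notation row := {ffun 'I_m -> 'I_M.+1}.
Local Notation spines := {ffun 'I_K -> 'I_M.+1}.

(** The rows that chain [i] can carry when the spine carries [x]: the entries
    [p], ..., [p + c] of chain [i] are the spine elements [c * i], ...,
    [c * i + c], consecutive chains sharing one of them. *)
Definition rows (A : {set row}) (x : spines) (i : 'I_n.+1) : {set row} :=
  [set h in A | [forall l : 'I_c.+1, h (inord (p + l)) == x (inord (c * i + l))]].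

Lemma rowsP (A : {set row}) (x : spines) (i : 'I_n.+1) h :
  reflect (h \in A /\ forall l, l <= c -> h (inord (p + l)) = x (inord (c * i + l)))
          (h \in rows A x i).
Proof.
rewrite inE; apply: (iffP andP) => -[hA H]; split=> //.
  by move=> l; rewrite -ltnS => lt_l; have /forallP/(_ (Ordinal lt_l))/eqP := H.
by apply/forallP => l; apply/eqP/H; rewrite -ltnS.
Qed.

Let decomp (A : {set row}) (X : {set spines}) :=
  [set u : spines * {ffun 'I_n.+1 -> row} |
    (u.1 \in X) && [forall i, u.2 i \in rows A u.1 i]].

Let card_decomp (A : {set row}) (X : {set spines}) :
  #|decomp A X| = \sum_(x in X) \prod_i #|rows A x i|.
Proof.
rewrite /decomp -sum1dep_card.
rewrite -(pair_big_dep (fun x => x \in X)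
  (fun x (h : {ffun 'I_n.+1 -> row}) => [forall i, h i \in rows A x i])
  (fun _ _ => 1)) /=.
apply: eq_bigr => x _; rewrite sum1dep_card cardsE.
transitivity #|family (fun i => rows A x i)|.
  by apply: eq_card => h; rewrite !inE.
by rewrite card_family foldrE big_map big_enum.
Qed.

(* The last spine element has index [c * n.+1], whose quotient by [c] is not the
   index of a chain; the minimum puts it on the last chain. *)
Let spine (k : nat) : poset :=
  let i := minn (k %/ c) n in at_ (inord i) (inord (p + (k - c * i))).

Let spineE (i : 'I_n.+1) l : l <= c -> spine (c * i + l) = at_ i (inord (p + l)).
Proof.
rewrite /spine leq_eqVlt => /predU1P[-> | lt_lc].
  rewrite -mulnSr mulKn //; have := ltn_ord i; rewrite ltnS leq_eqVlt.
  case/predU1P=> [ein | lt_in].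
    rewrite ein (minn_idPr (leqnSn n)) mulnSr addKn.
    by congr clusterA; apply: val_inj; rewrite /= inordK.
  rewrite (minn_idPl lt_in) subnn addn0; apply/esym/clusterA_glue.
  - by rewrite inordK.
  - by rewrite inordK //; lia.
  by rewrite inordK //; lia.
rewrite mulnC divnMDl // (divn_small lt_lc) addn0 (minn_idPl _); last first.
  by rewrite -ltnS.
by rewrite mulnC addKn inord_val.
Qed.

(** Reading off the spine and the chains loses nothing: every element of the
    poset lies on a chain. *)
Lemma card_strict_maps_cluster :
  #|strict_maps poset M.+1| <=
  \sum_(x in strict_maps 'I_K M.+1) \prod_(i < n.+1) #|rows (strict_maps 'I_m M.+1) x i|.
Proof.
rewrite -card_decomp.
pose F (g : {ffun poset -> 'I_M.+1}) :=
  ([ffun k : 'I_K => g (spine k)], [ffun i => [ffun j => g (at_ i j)]]).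
have F_inj : injective F.
  move=> g g' [_ /ffunP eq_g]; apply/ffunP => u.
  have := eq_g (repr u).1; rewrite !ffunE => /ffunP/(_ (repr u).2); rewrite !ffunE.
  by rewrite /clusterA -surjective_pairing reprK.
rewrite -(card_imset _ F_inj); apply: subset_leq_card.
apply/subsetP => _ /imsetP[g /strict_mapsP g_lt ->]; rewrite inE /F /=.
apply/andP; split.
  apply: strict_maps_succ => k k' ek'; rewrite !ffunE; apply: g_lt.
  have lt_k : k < c * n.+1 by have := ltn_ord k'; rewrite ek' ltnS.
  have lt_i : k %/ c < n.+1 by rewrite ltn_divLR // [n.+1 * c]mulnC.
  have lt_l : k %% c < c by rewrite ltn_mod.
  have ek : k = c * Ordinal lt_i + k %% c :> nat.
    by rewrite /= [c * (k %/ c)]mulnC -divn_eq.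
  rewrite ek' ek -[(c * Ordinal lt_i + _).+1]addnS !spineE //; last exact: ltnW.
  by apply: clusterA_lt; rewrite !inordK //; lia.
apply/forallP => i; apply/rowsP; split.
  by apply: strict_maps_succ => j k ek; rewrite !ffunE; apply/g_lt/clusterA_lt.
move=> l le_lc; rewrite !ffunE inordK ?spineE //.
by have := ltn_ord i; nia.
Qed.

(** A spine and rows compatible with it agree at every gluing point, so they
    descend to the quotient. *)
Lemma card_weak_maps_cluster :
  \sum_(x in weak_maps 'I_K M.+1) \prod_(i < n.+1) #|rows (weak_maps 'I_m M.+1) x i|
    <= #|weak_maps poset M.+1|.
Proof.
rewrite -card_decomp.
pose F (u : spines * {ffun 'I_n.+1 -> row}) :=
  [ffun v : poset => u.2 (repr v).1 (repr v).2].
have FE u i j : u \in decomp (weak_maps 'I_m M.+1) (weak_maps 'I_K M.+1) ->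
    F u (at_ i j) = u.2 i j.
  rewrite inE => /andP[_ /forallP u_rows]; rewrite ffunE.
  have glueE (v w : chain_pt n.+1 m) : glue a b v w -> u.2 v.1 v.2 = u.2 w.1 w.2.
    case: v w => [i1 j1] [i2 j2] /and3P[/= /eqP[ej1] /eqP ei2 /eqP[ej2]].
    have /rowsP[_ /(_ c (leqnn _)) E1] := u_rows i1.
    have /rowsP[_ /(_ 0 isT) E2] := u_rows i2.
    have -> : j1 = inord (p + c) by apply: val_inj; rewrite /= ej1 inordK //; lia.
    have -> : j2 = inord (p + 0) by apply: val_inj; rewrite /= ej2 addn0 inordK //; lia.
    by rewrite E1 E2 ei2 addn0 [c * i1.+1]mulnSr.
  have : glued a b (repr (at_ i j)) (i, j).
    by apply/(eqmodP (@glued_equiv n.+1 m a b)); rewrite reprK.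
  case/connectP=> s; elim: s (repr _) => [|w s IHs] v /=; first by move=> _ <-.
  by case/andP=> /orP[] /glueE vw /IHs{}IHs /IHs <-.
have F_inj : {in decomp (weak_maps 'I_m M.+1) (weak_maps 'I_K M.+1) &, injective F}.
  move=> u u' uD u'D /ffunP eq_F.
  have eq2 : u.2 = u'.2 by apply/ffunP => i; apply/ffunP => j; rewrite -!FE ?eq_F.
  rewrite [u]surjective_pairing [u']surjective_pairing eq2; congr pair.
  apply/ffunP => k.
  move: uD u'D; rewrite !inE => /andP[_ /forallP H] /andP[_ /forallP H'].
  have [i [l [le_lc ek]]] : exists (i : 'I_n.+1) l, l <= c /\ k = c * i + l :> nat.
    exists (inord (minn (k %/ c) n)), (k - c * minn (k %/ c) n).
    rewrite inordK ?ltnS ?geq_minr //; have := ltn_ord k; rewrite ltnS => le_k.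
    have := divn_eq k c; have := ltn_pmod k c_gt0.
    by case: (leqP (k %/ c) n) => ?; nia.
  have /rowsP[_ /(_ l le_lc)] := H i; have /rowsP[_ /(_ l le_lc)] := H' i.
  by rewrite -ek inord_val eq2 => -> ->.
rewrite -(card_in_imset F_inj); apply: subset_leq_card.
apply/subsetP => _ /imsetP[u uD ->]; apply/weak_mapsP => v w.
case/connectP=> s; elim: s v => [|v' s IHs] v /=; first by move=> _ ->.
case/andP=> /existsP[i /existsP[j /existsP[k]]].
case/and3P=> /eqP ek /eqP-> /eqP ev' /IHs{}IHs /IHs; apply: leq_trans.
rewrite ev' !FE //; move: uD; rewrite inE => /andP[_ /forallP/(_ i)].
by case/rowsP=> /weak_maps_ordP h_le _; apply: h_le; rewrite ek.
Qed.

(** Once its spine entries are fixed, a strict row is given by a set of [p]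
    values below the first of them and a set of [q] values above the last. *)
Lemma card_strict_rows (x : spines) (i : 'I_n.+1) :
  #|rows (strict_maps 'I_m M.+1) x i| <=
  'C(x (inord (c * i)), p) * 'C(M - x (inord (c * i + c)), q).
Proof.
set y := x _; set z := x (inord (c * i + c)).
rewrite -{1}(card_ord_lt (ltnW (ltn_ord y))) -card_ord_gt.
apply: leq_trans (leq_mul (card_strict_maps_in _ _) (card_strict_maps_in _ _)).
pose F (h : row) :=
  ([ffun j : 'I_p => h (inord j)], [ffun j : 'I_q => h (inord (p + c + j.+1))]).
rewrite -cardsX -(@card_in_imset _ _ F) => [|h h'].
  apply: subset_leq_card; apply/subsetP => _ /imsetP[h + ->].
  case/rowsP=> /strict_maps_ordP h_lt hE.
  have hy : h (inord p) = y by have := hE 0 isT; rewrite !addn0.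
  have hz : h (inord (p + c)) = z by have := hE c (leqnn _).
  rewrite in_setX /F /=; apply/andP; split; rewrite inE; apply/andP; split.
  - apply/strict_maps_ordP => j k lt_jk; rewrite !ffunE; apply: h_lt.
    by have lt_ord := ltn_ord k; rewrite !inordK; lia.
  - apply/forallP => j; rewrite inE ffunE -hy; apply: h_lt.
    by have lt_ord := ltn_ord j; rewrite !inordK; lia.
  - apply/strict_maps_ordP => j k lt_jk; rewrite !ffunE; apply: h_lt.
    by have lt_ord := ltn_ord k; rewrite !inordK; lia.
  apply/forallP => j; rewrite inE ffunE -hz; apply: h_lt.
  by have lt_ord := ltn_ord j; rewrite !inordK; lia.
case/rowsP=> _ hE /rowsP[_ h'E] [/ffunP lo /ffunP up]; apply/ffunP => j.
have := ltn_ord j; rewrite ltnS => lt_j.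
have [lt_jp | le_pj] := ltnP j p.
  by have := lo (Ordinal lt_jp); rewrite !ffunE /= inord_val.
have [lt_pcj | le_jpc] := ltnP (p + c) j.
  have lt_jq : j - (p + c).+1 < q by lia.
  have := up (Ordinal lt_jq); rewrite !ffunE /=.
  have -> // : inord (p + c + (j - (p + c).+1).+1) = j.
  by apply: val_inj; rewrite /= inordK; lia.
have le_jc : j - p <= c by lia.
by have := hE _ le_jc; rewrite -(h'E _ le_jc) subnKC // inord_val.
Qed.

(** Conversely, weakly increasing entries below the first spine value and above
    the last one can be completed by the spine entries. *)
Lemma card_weak_rows (x : spines) (i : 'I_n.+1) : x \in weak_maps 'I_K M.+1 ->
  'C(x (inord (c * i)) + p, p) * 'C(M - x (inord (c * i + c)) + q, q) <=
  #|rows (weak_maps 'I_m M.+1) x i|.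
Proof.
move=> /weak_maps_ordP x_le; set y := x _; set z := x (inord (c * i + c)).
rewrite -!card_weak_maps_ord -cardsX.
pose tn k N (t : {ffun 'I_k -> 'I_N}) (j : nat) : nat :=
  oapp (fun j' : 'I_k => t j' : nat) 0 (insub j).
have tnE k N (t : {ffun 'I_k -> 'I_N}) (j : 'I_k) : tn k N t j = t j.
  by rewrite /tn valK.
have tn_le k N (t : {ffun 'I_k -> 'I_N.+1}) j : tn _ _ t j <= N.
  by rewrite /tn; case: insubP => [u _ _|_] //=; rewrite -ltnS.
have xz k : k <= c -> x (inord (c * i + k)) <= z.
  by move=> le_kc; apply: x_le; have lt_ord := ltn_ord i; rewrite !inordK; nia.
pose hn (u : {ffun 'I_p -> 'I_y.+1} * {ffun 'I_q -> 'I_(M - z).+1}) (j : nat) :=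
  if j < p then tn _ _ u.1 j else
  if j <= p + c then x (inord (c * i + (j - p))) : nat else
  z + tn _ _ u.2 (j - (p + c).+1).
have hn_up u (j : 'I_q) : hn u (p + c + j.+1) = z + u.2 j.
  rewrite /hn; case: ltnP => [|_]; first lia.
  case: leqP => [|_]; first lia.
  by rewrite (_ : p + c + j.+1 - (p + c).+1 = j) ?tnE //; lia.
have hn_lt u j : hn u j < M.+1.
  rewrite /hn; case: ifP => _; last case: ifP => _; rewrite ?ltn_ord //.
    by apply: leq_ltn_trans (ltn_ord y); apply: tn_le.
  have := tn_le _ _ u.2 (j - (p + c).+1); have := ltn_ord z; lia.
pose F u : row := [ffun j : 'I_m => Ordinal (hn_lt u j)].
have F_inj : injective F.
  case=> t u [t' u'] /ffunP eqF.
  have {}eqF j : j < m -> hn (t, u) j = hn (t', u') j.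
    by move=> lt_j; have := eqF (Ordinal lt_j); rewrite !ffunE => /(congr1 val).
  congr pair; apply/ffunP => j; apply: val_inj => /=; have := ltn_ord j => lt_j.
    have := eqF j; rewrite /hn lt_j !tnE; apply; lia.
  have := eqF (p + c + j.+1).
  by rewrite !hn_up => /(_ _)/addnI; apply; lia.
rewrite -(card_imset _ F_inj); apply: subset_leq_card.
apply/subsetP => h /imsetP[[t u]]; rewrite in_setX.
case/andP=> /= /weak_maps_ordP t_le /weak_maps_ordP u_le ->.
apply/rowsP; split; last first.
  move=> l le_lc; rewrite ffunE; apply: val_inj; rewrite /= inordK; last by lia.
  by rewrite /hn ltnNge leq_addr /= leq_add2l le_lc addKn.
apply: weak_maps_succ => j k ek; have := ltn_ord k; rewrite !ffunE /= ek => lt_k.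
have tnle r N (s : {ffun 'I_r -> 'I_N}) e f :
    (forall e' f' : 'I_r, e' <= f' -> s e' <= s f') -> e <= f -> f < r ->
    tn _ _ s e <= tn _ _ s f.
  move=> s_le le_ef lt_f; have lt_e := leq_ltn_trans le_ef lt_f.
  by rewrite (tnE _ _ s (Ordinal lt_f)) (tnE _ _ s (Ordinal lt_e)); apply: s_le.
rewrite /hn; case: (ltnP j.+1 p) => lt1; first by rewrite (ltnW lt1); apply: tnle.
case: (ltnP j p) => lt2.
  case: (leqP j.+1 (p + c)) => [_|]; last by clear -lt2; lia.
  have -> : j.+1 - p = 0 by clear -lt2; lia.
  by rewrite addn0; apply: tn_le.
case: (leqP j.+1 (p + c)) => lt3.
  rewrite (ltnW lt3); apply: x_le; have lt_ord := ltn_ord i; rewrite !inordK; nia.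
case: (leqP j (p + c)) => lt4.
  by apply: leq_trans (leq_addr _ _); apply: xz; lia.
by rewrite leq_add2l; apply: tnle => //; lia.
Qed.

End Rows.

(** Each class has exactly one point that is not of the form [(i, p + c)] with
    [i < n], since such a point is glued to [(i + 1, p)]. *)
Lemma card_cluster : #|{: poset}| = n.+1 * m - n.
Proof.
pose nf (v : chain_pt n.+1 m) : chain_pt n.+1 m :=
  if (v.1 < n) && (v.2 == p + c :> nat) then (inord v.1.+1, inord p) else v.
have inord_p : (inord p : 'I_m) = p :> nat by rewrite inordK //; lia.
have nf_glued v : glued a b v (nf v).
  rewrite /nf; case: ifP => [/andP[lt_v /eqP ev]|_]; last exact: connect0.
  apply: connect1; rewrite /glue_sym /glue /= ev inord_p inordK ?ltnS //.
  by rewrite !eqxx.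
have nf_glue v w : glue a b v w -> nf v = nf w.
  case: v w => [i j] [i' j'] /and3P[/= /eqP[ej] /eqP ei' /eqP[ej']].
  rewrite /nf /= ej ej' eqxx andbT.
  rewrite (_ : p == p + c = false) ?andbF; last by apply/eqP; lia.
  have -> : i < n by have := ltn_ord i'; rewrite ei' ltnS.
  by congr pair; apply: val_inj; rewrite /= ?inord_p ?inordK ?ei' // -?ei' ?ej'.
have nfE v w : glued a b v w -> nf v = nf w.
  case/connectP=> s; elim: s v => [|u s IHs] v /=; first by move=> _ ->.
  by case/andP=> /orP[] /nf_glue vu /IHs{}IHs /IHs <-.
have repr_inj : injective (fun u : poset => nf (repr u)).
  move=> u u' eq_nf; rewrite -[u]reprK -[u']reprK.
  apply/(eqmodP (@glued_equiv n.+1 m a b)).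
  apply: glued_trans (nf_glued _) _; rewrite eq_nf glued_sym; exact: nf_glued.
pose moved := setX [set i : 'I_n.+1 | i < n] [set (inord (p + c) : 'I_m)].
have inord_pc : (inord (p + c) : 'I_m) = p + c :> nat by rewrite inordK //; lia.
have nf_moved v : (nf v == v) = (v \notin moved).
  rewrite [v]surjective_pairing in_setX !inE /nf /=.
  rewrite -(inj_eq val_inj v.2) /= inord_pc.
  case: ifP => [/andP[_ /eqP ev2] | _]; last by rewrite -surjective_pairing eqxx.
  apply/eqP => /(congr1 (fun w : chain_pt n.+1 m => val w.2)) /=.
  by rewrite inord_p ev2; lia.
have card_moved : #|moved| = n by rewrite cardsX cards1 muln1 card_ord_lt.
have -> : n.+1 * m - n = #|~: moved|.
  have := cardsC moved; rewrite card_moved card_prod !card_ord; lia.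
rewrite -(card_imset _ repr_inj); apply: eq_card => v; rewrite in_setC -nf_moved.
apply/imsetP/eqP => [[u _ ->] | nf_v]; first by rewrite -(nfE _ _ (nf_glued _)).
exists (\pi_poset v)%qT => //; rewrite -[LHS]nf_v; apply: nfE.
by rewrite glued_sym; apply/(eqmodP (@glued_equiv n.+1 m a b)); rewrite reprK.
Qed.

End Cluster.

Import Order.TTheory GRing.Theory Num.Theory.

(** * Elementary inequalities *)

Section Inequalities.

Local Open Scope ring_scope.

Lemma bernoulli (h : rat) k : -1 <= h -> 1 + k%:R * h <= (1 + h) ^+ k.
Proof.
move=> h_ge; elim: k => [|k IHk]; first by rewrite mul0r addr0.
rewrite exprS -natr1; have h1_ge0 : 0 <= 1 + h by lra.
apply: le_trans (ler_wpM2l h1_ge0 IHk); have : 0 <= k%:R * (h * h).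
  by rewrite mulr_ge0 // -expr2 sqr_ge0.
lra.
Qed.

Lemma bernoulli_div (u : rat) c : (0 < c)%N -> 0 <= u -> 1 + u <= (1 + u / c%:R) ^+ c.
Proof.
move=> c_gt0 u_ge0; have c_neq0 : c%:R != 0 :> rat by rewrite pnatr_eq0 -lt0n.
apply: le_trans (bernoulli _ _); first by rewrite mulrC divfK.
by apply: (@le_trans _ _ 0) => //; rewrite divr_ge0.
Qed.

(** Bernoulli bounds [1 - u] by the power [c] of [1 - u / c]; the product of the
    two powers is then that of [1 - (u / c) ^ 2]. *)
Lemma bernoulli_conj (u : rat) c :
  (0 < c)%N -> 0 <= u <= 1 -> (1 + u / c%:R) ^+ c * (1 - u) <= 1.
Proof.
move=> c_gt0 /andP[u_ge0 u_le1].
have c_ge1 : 1 <= c%:R :> rat by rewrite ler1n.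
have uc_le : u / c%:R <= u by rewrite ler_pdivrMr; nra.
have uc_ge0 : 0 <= u / c%:R by rewrite divr_ge0.
have cuc : c%:R * (u / c%:R) = u by rewrite mulrC divfK // gt_eqF ?ltr0n.
set w := u / c%:R in uc_le uc_ge0 cuc *.
apply: (@le_trans _ _ ((1 + w) ^+ c * (1 - w) ^+ c)).
  rewrite ler_wpM2l ?exprn_ge0 //; first lra.
  by apply: le_trans (bernoulli _ _); last lra; rewrite mulrN cuc.
by rewrite -exprMn exprn_ile1 //; nra.
Qed.

(** The ratio of the two powers tends to one when [X] outgrows [s ^ 2]. *)
Lemma shifted_power_ratio (s X : nat) : (s <= X)%N -> (0 < X)%N ->
  (1 - (2 * s ^ 2)%:R / (X + s)%:R) * (X + s)%:R ^+ s <= (X - s)%:R ^+ s :> rat.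
Proof.
move=> le_sX X_gt0; have Xs_gt0 : 0 < (X + s)%:R :> rat by rewrite ltr0n addn_gt0 X_gt0.
have -> : (X - s)%:R = (1 + - ((2 * s)%:R / (X + s)%:R)) * (X + s)%:R :> rat.
  rewrite mulrDl mul1r mulNr divfK ?gt_eqF // natrB // natrD natrM; ring.
rewrite exprMn; apply: ler_wpM2r; first by rewrite exprn_ge0 ?ltW.
apply: le_trans (bernoulli _ _).
  by rewrite le_eqVlt; apply/orP; left; apply/eqP; rewrite expnS expn1 !natrM; ring.
rewrite lerN2 ler_pdivrMr // mul1r ler_nat; lia.
Qed.

Lemma natr_ffact_le n k : (n ^_ k)%:R <= n%:R ^+ k :> rat.
Proof.
elim: k => [|k IHk]; first by rewrite ffactn0.
rewrite ffactnSr natrM exprSr; apply: ler_pM => //.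
by rewrite ler_nat leq_subr.
Qed.

Lemma natr_ffact_ge n s k : (k <= s)%N -> (n - s)%:R ^+ k <= (n ^_ k)%:R :> rat.
Proof.
elim: k => [|k IHk] lt_ks; first by rewrite ffactn0.
rewrite ffactnSr natrM exprSr; apply: ler_pM => //; rewrite ?exprn_ge0 //.
  by apply: IHk; apply: ltnW.
by rewrite ler_nat leq_sub2l // ltnW.
Qed.

(** Induction on the degree: below [theta] there is a square, whose power [n] is
    the product of two exponentials, one for the polynomial of lower degree and
    one for the additional factor [n]. *)
Lemma exponential_beats_polynomial (theta A : rat) k : 1 < theta ->
  exists N, forall n, (N <= n)%N -> A * n%:R ^+ k < theta ^+ n.
Proof.
elim: k theta A => [|k IHk] theta A theta_gt1.
  have t1_gt0 : 0 < theta - 1 by lra.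
  exists (Num.bound (`|A| / (theta - 1))) => n le_n; rewrite expr0 mulr1.
  have := bernoulli n (_ : -1 <= theta - 1); rewrite subrKC => b.
  apply: lt_le_trans (b _); last lra.
  have : `|A| / (theta - 1) < n%:R.
    apply: lt_le_trans (archi_boundP _) _; last by rewrite ler_nat.
    by rewrite divr_ge0 // ltW.
  by rewrite ltr_pdivrMr //; have := ler_norm A; lra.
(* with this choice of [d], [(1 + d) ^ 2 <= 1 + 3 * d <= theta] *)
pose d := Num.min ((theta - 1) / 3%:R) 1.
have d_gt0 : 0 < d by rewrite lt_min; apply/andP; split; lra.
have d_le1 : d <= 1 by rewrite ge_min lexx orbT.
have d_le : d <= (theta - 1) / 3%:R by rewrite ge_min lexx.
have [N HN] := IHk (1 + d) (`|A| / d) ltac:(lra).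
exists N => n /HN lt_n.
have : ((1 + d) ^+ 2) ^+ n <= theta ^+ n by rewrite lerXn2r ?nnegrE //; nra.
apply: lt_le_trans; rewrite -exprM mul2n -addnn exprD.
have b := bernoulli n (_ : -1 <= d).
have {}b : n%:R * d < (1 + d) ^+ n by apply: lt_le_trans (b _); lra.
apply: le_lt_trans (_ : (`|A| / d * n%:R ^+ k) * (n%:R * d) < _).
  rewrite (_ : _ * _ * _ = `|A| * n%:R ^+ k.+1); last first.
    by rewrite exprSr; field; rewrite gt_eqF.
  by rewrite ler_wpM2r ?exprn_ge0 // ler_norm.
by apply: ltr_pM => //; rewrite mulr_ge0 ?divr_ge0 ?exprn_ge0 // ltW.
Qed.

End Inequalities.

(** * The weights *)

Section Weights.

Local Open Scope ring_scope.

Variable c : nat.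
Hypothesis c_gt0 : (0 < c)%N.

(** A rational stand-in for [x] to the power [p / c]: it equals the binomial
    coefficient of [x + p / c] over [x]. *)
Definition phi (p x : nat) : rat :=
  \prod_(i < x) ((c * i.+1 + p)%:R / (c * i.+1)%:R).

Lemma phiS p x : phi p x.+1 = phi p x * ((c * x.+1 + p)%:R / (c * x.+1)%:R).
Proof. by rewrite /phi big_ord_recr. Qed.

Let cx_gt0 x : 0 < (c * x.+1)%:R :> rat.
Proof. by rewrite ltr0n muln_gt0 c_gt0. Qed.

Lemma phi_factor p x :
  (c * x.+1 + p)%:R / (c * x.+1)%:R = 1 + p%:R / x.+1%:R / c%:R :> rat.
Proof.
rewrite natrD mulrDl divff ?gt_eqF // natrM invfM mulrA [_ / c%:R * _]mulrAC.
by [].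
Qed.

Lemma phi_gt0 p x : 0 < phi p x.
Proof. by apply: prodr_gt0 => i _; rewrite divr_gt0 // ltr0n addn_gt0 muln_gt0 c_gt0. Qed.

Lemma phi_factor_ge1 p x : 1 <= (c * x.+1 + p)%:R / (c * x.+1)%:R :> rat.
Proof. by rewrite phi_factor lerDl !divr_ge0. Qed.

Lemma phi_le p : {homo phi p : x y / (x <= y)%N >-> x <= y}.
Proof.
apply: homo_leq => [//|? ? ?|x]; first exact: le_trans.
by rewrite phiS ler_peMr ?phi_factor_ge1 // ltW // phi_gt0.
Qed.

Lemma phi_ge1 p x : 1 <= phi p x.
Proof. by have := @phi_le p 0%N x isT; rewrite {1}/phi big_ord0. Qed.

Lemma phi_ub p x : phi p x <= x.+1%:R ^+ p.
Proof.
elim: x => [|x IHx]; first by rewrite /phi big_ord0 expr1n.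
rewrite phiS; have x_gt0 : 0 < x.+1%:R :> rat by rewrite ltr0n.
have -> : x.+2%:R ^+ p = x.+1%:R ^+ p * (1 + x.+1%:R^-1) ^+ p :> rat.
  by rewrite -exprMn mulrDr divff ?gt_eqF // mulr1 natr1.
apply: ler_pM IHx _; [exact/ltW/phi_gt0 | by rewrite divr_ge0 |].
apply: le_trans (bernoulli _ _); last first.
  by apply: (@le_trans _ _ 0) => //; rewrite invr_ge0.
rewrite phi_factor lerD2l ler_pdivrMr ?ltr0n // ler_peMr ?ler1n //.
by rewrite divr_ge0.
Qed.

(** Since [phi p x ^+ c] grows like a constant times [x ^ p / p!], these ratios
    have a common limit; [beta] increases to it and [alpha] decreases to it, so
    that their values at one point [X] bound [phi p x ^+ c] for all [x]. *)
Definition beta (p x : nat) : rat := phi p x ^+ c / 'C(x + p, p)%:R.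
Definition alpha (p x : nat) : rat := phi p x ^+ c / 'C(x, p)%:R.

Let binD_gt0 x p : 0 < 'C(x + p, p)%:R :> rat.
Proof. by rewrite ltr0n bin_gt0 leq_addl. Qed.

Lemma beta_gt0 p x : 0 < beta p x.
Proof. by rewrite divr_gt0 ?exprn_gt0 ?phi_gt0. Qed.

(** The step from [x] to [x + 1] multiplies [beta] by [(1 + u / c) ^ c / (1 + u)]
    with [u = p / (x + 1)]. *)
Lemma beta_le p : {homo beta p : x y / (x <= y)%N >-> x <= y}.
Proof.
apply: homo_leq => [//|? ? ?|x]; first exact: le_trans.
rewrite /beta ler_pdivrMr // mulrAC ler_pdivlMr // phiS exprMn -!mulrA.
rewrite ler_pM2l ?exprn_gt0 ?phi_gt0 // phi_factor.
apply: le_trans (ler_wpM2r (ltW (binD_gt0 _ _)) (bernoulli_div c_gt0 _)).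
  have x_gt0 : 0 < x.+1%:R :> rat by rewrite ltr0n.
  have -> : 1 + p%:R / x.+1%:R = (x.+1 + p)%:R / x.+1%:R :> rat.
    by rewrite natrD mulrDl divff ?gt_eqF.
  rewrite mulrAC ler_pdivlMr // -!natrM ler_nat addSn.
  by rewrite (mul_bin_down (x + p).+1) -addSn addnK mulnC.
by rewrite divr_ge0.
Qed.

(** The step from [z] to [z + 1] multiplies [alpha] by [(1 + u / c) ^ c * (1 - u)]
    with [u = p / (z + 1)]. *)
Lemma alpha_ge p x y : (p <= x <= y)%N -> alpha p y <= alpha p x.
Proof.
case/andP=> le_px le_xy; rewrite -(subnKC le_xy); elim: (y - x)%N => [|k IHk].
  by rewrite addn0.
rewrite addnS; apply: le_trans IHk; set z := (x + k)%N.
have le_pz : (p <= z)%N by rewrite (leq_trans le_px) ?leq_addr.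
have bz_gt0 : 0 < 'C(z, p)%:R :> rat by rewrite ltr0n bin_gt0.
have z_gt0 : 0 < z.+1%:R :> rat by rewrite ltr0n.
rewrite /alpha ler_pdivrMr ?ltr0n ?bin_gt0 ?leqW // mulrAC ler_pdivlMr //.
rewrite phiS exprMn -!mulrA ler_pM2l ?exprn_gt0 ?phi_gt0 // phi_factor.
have -> : 'C(z, p)%:R = 'C(z.+1, p)%:R * (1 - p%:R / z.+1%:R) :> rat.
  have -> : 1 - p%:R / z.+1%:R = (z.+1 - p)%:R / z.+1%:R :> rat.
    by rewrite natrB ?leqW // mulrBl divff ?gt_eqF.
  rewrite mulrA; apply: canRL (mulfK _) _; first by rewrite gt_eqF.
  rewrite -!natrM; congr _%:R.
  by rewrite mulnC (mul_bin_down z.+1 p) mulnC.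
rewrite mulrCA ler_piMr // bernoulli_conj // divr_ge0 //=.
by rewrite ler_pdivrMr // mul1r ler_nat leqW.
Qed.

Lemma beta_le_alpha p x : (p <= x)%N -> beta p x <= alpha p x.
Proof.
move=> le_px; rewrite /beta /alpha ler_pM2l ?exprn_gt0 ?phi_gt0 //.
rewrite lef_pV2 ?posrE ?ltr0n ?bin_gt0 ?leq_addl // ler_nat.
by apply: leq_bin2l; rewrite leq_addr.
Qed.

(** For [p <= x < X] the bound goes through [alpha], which is at least as large
    at [x] as at [X], where it is at least [beta]. *)
Lemma strict_weight p x X : 'C(x, p)%:R * beta p X <= phi p x ^+ c.
Proof.
have [lt_xp | le_px] := ltnP x p.
  by rewrite bin_small // mul0r exprn_ge0 // ltW ?phi_gt0.
have bx_gt0 : 0 < 'C(x, p)%:R :> rat by rewrite ltr0n bin_gt0.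
rewrite mulrC -ler_pdivlMr // -/(alpha p x).
have [le_Xx | /ltnW le_xX] := leqP X x.
  by apply: le_trans (beta_le p le_Xx) _; apply: beta_le_alpha.
apply: le_trans (beta_le_alpha (leq_trans le_px le_xX)) _.
by apply: alpha_ge; rewrite le_px.
Qed.

Lemma weak_weight p x X : (p <= X)%N ->
  phi p x ^+ c <= 'C(x + p, p)%:R * alpha p X.
Proof.
move=> le_pX; rewrite mulrC -ler_pdivrMr // -/(beta p x).
have [le_Xx | /ltnW le_xX] := leqP X x.
  apply: le_trans (beta_le_alpha (leq_trans le_pX le_Xx)) _.
  by apply: alpha_ge; rewrite le_pX.
by apply: le_trans (beta_le p le_xX) _; apply: beta_le_alpha.
Qed.

(** The Vandermonde convolution with rational upper indices. Multiplying the sum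
    for [M + 1] by [c * (M + 1) = c * v + c * (M + 1 - v)] and absorbing each
    part into a factor [phi] gives a multiple of the sum for [M]. *)
Lemma sum_phi p q M :
  \sum_(v < M.+1) phi p v * phi q (M - v) = phi (p + q + c) M.
Proof.
elim: M => [|M IHM].
  by rewrite big_ord_recl big_ord0 /phi !big_ord0 mulr1 addr0.
rewrite phiS -IHM mulrA; apply: canRL (mulfK _) _; first by rewrite gt_eqF.
transitivity (\sum_(v < M.+2) (c * v)%:R * (phi p v * phi q (M.+1 - v))
   + \sum_(v < M.+2) (c * (M.+1 - v))%:R * (phi p v * phi q (M.+1 - v))).
  rewrite -big_split mulr_suml /=; apply: eq_bigr => v _.
  by rewrite -mulrDl -natrD -mulnDr subnKC 1?mulrC // -ltnS.
rewrite big_ord_recl [X in _ + X]big_ord_recr /= subnn muln0 !mul0r add0r addr0.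
rewrite -big_split mulr_suml /=; apply: eq_bigr => v _.
have le_vM : (v <= M)%N by rewrite -ltnS.
rewrite /bump add1n subSS (subSn le_vM) !phiS.
have e1 := cx_gt0 v; have e2 := cx_gt0 (M - v).
have -> : (c * M.+1 + (p + q + c))%:R =
          (c * v.+1 + p)%:R + (c * (M - v).+1 + q)%:R :> rat.
  by rewrite -natrD; congr _%:R; rewrite -{1}(subnKC le_vM); lia.
move: (c * v.+1 + p)%:R (c * (M - v).+1 + q)%:R => s t.
move: (c * v.+1)%:R (c * (M - v).+1)%:R e1 e2 => e f e_gt0 f_gt0.
by field; rewrite !gt_eqF.
Qed.

(** The ratio of consecutive values at [v] and [v + 1] is at least one exactly
    when [q * (v + 1) <= p * (M - v)], which gives the mode [mu]. *)
Lemma phi_convolution_mode p q M : (0 < q)%N ->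
  let V v := phi p v * phi q (M - v) in
  exists mu, [/\ (mu <= M)%N,
    forall u v, (u <= v <= mu)%N -> V u <= V v &
    forall u v, (mu <= u <= v)%N -> (v <= M)%N -> V v <= V u].
Proof.
move=> q_gt0 V; pose mu := ((p * M.+1) %/ (p + q))%N; exists mu.
have pq_gt0 : (0 < p + q)%N by rewrite addn_gt0 q_gt0 orbT.
have muP v : (v < mu)%N = ((p + q) * v.+1 <= p * M.+1)%N.
  by rewrite /mu leq_divRL // mulnC.
have le_muM : (mu <= M)%N.
  by rewrite leqNgt muP -ltnNge mulnDl -{1}[(p * M.+1)%N]addn0 ltn_add2l muln_gt0 q_gt0.
have stepE v : (v < M)%N ->
    V v = phi p v * phi q (M - v.+1) * (1 + q%:R / (M - v)%:R / c%:R) /\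
    V v.+1 = phi p v * phi q (M - v.+1) * (1 + p%:R / v.+1%:R / c%:R).
  move=> lt_vM; rewrite /V -(subnSK lt_vM) !phiS !phi_factor.
  by split; [rewrite mulrA | rewrite mulrAC].
have pos v : 0 < phi p v * phi q (M - v.+1) by rewrite mulr_gt0 ?phi_gt0.
have Mv_gt0 v : (v < M)%N -> 0 < (M - v)%:R :> rat by rewrite ltr0n subn_gt0.
have cinv : 0 < c%:R^-1 :> rat by rewrite invr_gt0 ltr0n.
split=> //.
  move=> u v /andP[le_uv le_vmu]; rewrite -(subnKC le_uv) in le_vmu *.
  elim: (v - u)%N le_vmu => [|k IHk]; first by rewrite addn0.
  rewrite addnS => lt_mu; apply: le_trans (IHk (ltnW lt_mu)) _.
  have lt_M := leq_trans lt_mu le_muM; have [-> ->] := stepE _ lt_M.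
  rewrite ler_pM2l // lerD2l ler_pM2r // ler_pdivrMr ?Mv_gt0 //.
  rewrite mulrAC ler_pdivlMr ?ltr0n // -!natrM ler_nat.
  have := lt_mu; rewrite muP mulnDl -[M in (_ <= _ * M.+1)%N -> _](subnKC (ltnW lt_M)).
  rewrite -addSn mulnDr; lia.
move=> u v /andP[le_muu le_uv]; rewrite -(subnKC le_uv).
elim: (v - u)%N => [|k IHk]; first by rewrite addn0.
rewrite addnS => lt_M; apply: le_trans (IHk (ltnW lt_M)).
have [-> ->] := stepE _ lt_M.
rewrite ler_pM2l // lerD2l ler_pM2r // ler_pdivrMr ?ltr0n //.
rewrite mulrAC ler_pdivlMr ?Mv_gt0 // -!natrM ler_nat.
have : ~~ (u + k < mu)%N by rewrite -leqNgt (leq_trans le_muu) ?leq_addr.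
rewrite muP -ltnNge mulnDl -[M in (_ * M.+1 < _)%N -> _](subnKC (ltnW lt_M)).
rewrite -addSn mulnDr; lia.
Qed.

End Weights.

(** * The growth rates are strictly ordered *)

Lemma factM_le u v d : u <= v -> (u + d)`! * v`! <= u`! * (v + d)`!.
Proof.
move=> le_uv; elim: d => [|d IHd]; first by rewrite !addn0.
rewrite !addnS !factS -mulnA [u`! * _]mulnCA; apply: leq_mul IHd.
by rewrite ltnS leq_add2r.
Qed.

(** The products [alpha c p' X * alpha c q' X] and [beta c p X * beta c q X] tend,
    as [X] grows, to the constants that govern the two growth rates. Their ratio
    involves the factors [r j = (j + p') * (j + q') / ((j + p) * (j + q))]: the
    weights contribute [r (c * i) ^ c], whereas the factorials contribute the
    product of all the [r j]. As [r] decreases, each power is smaller than the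
    product of the block of [c] factors that ends with it, and the first block
    shows that the inequality stays strict in the limit. *)
Section Gap.

Local Open Scope ring_scope.

Variables (c p q p' q' : nat).
Hypotheses (c_gt1 : (1 < c)%N) (le_pq' : (p' <= q')%N) (lt_pp' : (p < p')%N).
Hypothesis sumE : (p + q = p' + q')%N.

Let c_gt0 : (0 < c)%N := ltnW c_gt1.

Let r (j : nat) : rat := ((j + p') * (j + q'))%:R / ((j + p) * (j + q))%:R.

Let den_gt0 j : 0 < ((j.+1 + p) * (j.+1 + q))%:R :> rat.
Proof. by rewrite ltr0n muln_gt0. Qed.

Let r_gt0 j : 0 < r j.+1.
Proof. by rewrite divr_gt0 // ltr0n muln_gt0. Qed.

Let prod_lt : (p * q < p' * q')%N.
Proof. by nia. Qed.

Let r_lt i j : (i < j)%N -> r j.+1 < r i.+1.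
Proof.
move=> lt_ij; rewrite /r ltr_pdivrMr // mulrAC ltr_pdivlMr // -!natrM ltr_nat.
have E k : ((k.+1 + p') * (k.+1 + q') =
            (k.+1 + p) * (k.+1 + q) + (p' * q' - p * q))%N by nia.
rewrite !E; set d := (_ - _)%N; have d_gt0 : (0 < d)%N by rewrite subn_gt0.
have lt_ba : ((i.+1 + p) * (i.+1 + q) < (j.+1 + p) * (j.+1 + q))%N.
  by apply: ltn_mul; lia.
move: lt_ba d_gt0; move: ((j.+1 + p) * (j.+1 + q))%N ((i.+1 + p) * (i.+1 + q))%N d.
by clear; nia.
Qed.

Let r_le i j : (i <= j)%N -> r j.+1 <= r i.+1.
Proof. by rewrite leq_eqVlt => /predU1P[-> // | /r_lt/ltW]. Qed.

Let T Y : rat := \prod_(j < Y) r j.+1.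

Let T_gt0 Y : 0 < T Y.
Proof. by apply: prodr_gt0. Qed.

Let TE Y : T Y * ((Y + p)`! * (Y + q)`! * (p'`! * q'`!))%:R =
           ((Y + p')`! * (Y + q')`! * (p`! * q`!))%:R.
Proof.
elim: Y => [|Y IHY]; first by rewrite /T big_ord0 mul1r !add0n [in RHS]mulnC.
rewrite /T big_ord_recr -/(T Y) /= !addSn !factS -!addSn.
have -> : (((Y.+1 + p') * (Y + p')`!) * ((Y.+1 + q') * (Y + q')`!) * (p`! * q`!) =
           ((Y + p')`! * (Y + q')`! * (p`! * q`!)) * ((Y.+1 + p') * (Y.+1 + q')))%N.
  by ring.
have -> : (((Y.+1 + p) * (Y + p)`!) * ((Y.+1 + q) * (Y + q)`!) * (p'`! * q'`!) =
           ((Y + p)`! * (Y + q)`! * (p'`! * q'`!)) * ((Y.+1 + p) * (Y.+1 + q)))%N.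
  by ring.
by rewrite natrM [RHS]natrM -IHY /r mulrACA divfK // gt_eqF.
Qed.

(* The part of the telescoped product that depends on [Y] is at most one by
   log-convexity of the factorial. *)
Let T_le Y : T Y * (p'`! * q'`!)%:R <= (p`! * q`!)%:R.
Proof.
have f_gt0 : 0 < ((Y + p)`! * (Y + q)`!)%:R :> rat by rewrite ltr0n muln_gt0 !fact_gt0.
rewrite -(ler_pM2r f_gt0) -mulrA -[in leLHS]natrM [(p'`! * _ * _)%N]mulnC TE -natrM.
rewrite ler_nat mulnC leq_mul2l; apply/orP; right.
have -> : (Y + p' = Y + p + (p' - p))%N by lia.
have -> : (Y + q = Y + q' + (p' - p))%N by lia.
by apply: factM_le; lia.
Qed.

Let ratio_step x :
  (phi c p' x.+1 * phi c q' x.+1) / (phi c p x.+1 * phi c q x.+1) =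
  (phi c p' x * phi c q' x) / (phi c p x * phi c q x) * r (c * x.+1).
Proof.
rewrite /r !natrM !phiS.
have cx_gt0 : 0 < (c * x.+1)%:R :> rat by rewrite ltr0n muln_gt0 c_gt0.
have ge0 u : 0 < (c * x.+1 + u)%:R :> rat by rewrite natrD ltr_wpDr.
move: (phi_gt0 c_gt0 p x) (phi_gt0 c_gt0 q x) (ge0 p) (ge0 q) cx_gt0.
move: (phi c p x) (phi c q x) (phi c p' x) (phi c q' x) => A B A' B'.
move: (c * x.+1 + p)%:R (c * x.+1 + q)%:R (c * x.+1 + p')%:R (c * x.+1 + q')%:R.
move: (c * x.+1)%:R => C D E D' E' A_gt0 B_gt0 D_gt0 E_gt0 C_gt0.
by field; rewrite !gt_eqF.
Qed.

(* Among [r Y.+1], ..., [r (Y + c)] the last factor is the smallest. *)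
Let T_block Y k : (k <= c)%N -> T Y * r (Y + c) ^+ k <= T (Y + k).
Proof.
elim: k => [|k IHk] lt_kc; first by rewrite mulr1 addn0.
rewrite exprSr mulrA addnS /T big_ord_recr /= -/(T (Y + k)).
have r_ge0 : 0 <= r (Y + c) by rewrite -(prednK c_gt0) addnS; exact/ltW/r_gt0.
apply: ler_pM => //; first by rewrite mulr_ge0 ?exprn_ge0 //; exact/ltW/T_gt0.
  exact/IHk/ltnW.
by rewrite -(prednK c_gt0) addnS; apply: r_le; lia.
Qed.

Let theta := r c / r 1.

Let theta_gt0 : 0 < theta.
Proof. by rewrite divr_gt0 // -(prednK c_gt0). Qed.

Let theta_lt1 : theta < 1.
Proof.
by rewrite ltr_pdivrMr // mul1r -(prednK c_gt0); apply: r_lt; rewrite -ltnS prednK.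
Qed.

(* The first block has [r 1] where the power has [r c]: this gains [theta]. *)
Let ratio_le x :
  ((phi c p' x.+1 * phi c q' x.+1) / (phi c p x.+1 * phi c q x.+1)) ^+ c
  <= theta * T (c * x.+1).
Proof.
elim: x => [|x IHx].
  rewrite ratio_step /phi !big_ord0 !mulr1 ?divr1 mul1r muln1.
  have T1 : T 1 = r 1 by rewrite /T big_ord1.
  have rc_gt0 : 0 < r c by rewrite -(prednK c_gt0).
  have : r 1 * r c ^+ c.-1 <= T c.
    have rS k : (k < c)%N -> r 1 * r c ^+ k <= T k.+1.
      elim: k => [|k IHk] lt_kc; first by rewrite mulr1 -T1.
      rewrite exprSr mulrA /T big_ord_recr /= -/(T k.+1).
      apply: ler_pM; [|exact: ltW rc_gt0| exact/IHk/ltnW |].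
        exact: mulr_ge0 (ltW (r_gt0 0)) (exprn_ge0 _ (ltW rc_gt0)).
      by rewrite -(prednK c_gt0); apply: r_le; lia.
    by have := rS c.-1; rewrite prednK // => ->.
  move=> /(ler_wpM2l (ltW theta_gt0)); apply: le_trans.
  rewrite /theta mulrA divfK ?gt_eqF // -exprS prednK //.
rewrite ratio_step exprMn [(c * x.+2)%N]mulnSr.
apply: le_trans (ler_wpM2l (ltW theta_gt0) (T_block _ (leqnn c))).
rewrite mulrA -mulnSr ler_wpM2r // exprn_ge0 // -(prednK c_gt0) mulSn addSn.
exact/ltW/r_gt0.
Qed.

(** Once [X] is so large that falling factorials and powers of [X] agree up to a
    factor above [theta], the strict gain [theta] survives. *)
Lemma alpha_beta_gap : exists X, [/\ (p' <= X)%N, (q' <= X)%N &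
  alpha c p' X * alpha c q' X < beta c p X * beta c q X].
Proof.
pose s := (p + q)%N; pose X := (s + Num.bound ((2 * s ^ 2)%:R / (1 - theta)))%N.
have t1_gt0 : 0 < 1 - theta by rewrite subr_gt0 theta_lt1.
have le_sX : (s <= X)%N by rewrite leq_addr.
have s_gt0 : (0 < s)%N by rewrite /s sumE; lia.
have X_gt0 : (0 < X)%N by apply: leq_trans le_sX.
exists X; split; [rewrite /s in le_sX; lia | rewrite /s in le_sX; lia |].
have Xs_gt0 : 0 < (X + s)%:R :> rat by rewrite ltr0n addn_gt0 X_gt0.
have big_X : theta < 1 - (2 * s ^ 2)%:R / (X + s)%:R.
  rewrite ltrBrDl -ltrBrDr.
  rewrite ltr_pdivrMr // mulrC -ltr_pdivrMr //.
  apply: lt_le_trans (archi_boundP _) _; first by rewrite divr_ge0 // ltW.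
  by rewrite ler_nat /X addnAC leq_addl.
have binD_gt0 u : 0 < 'C(X + u, u)%:R :> rat by rewrite ltr0n bin_gt0 leq_addl.
have bin'_gt0 u : (u <= X)%N -> 0 < 'C(X, u)%:R :> rat by rewrite ltr0n bin_gt0.
have le_p'X : (p' <= X)%N by rewrite /s in le_sX; lia.
have le_q'X : (q' <= X)%N by rewrite /s in le_sX; lia.
pose P := phi c p X * phi c q X; pose P' := phi c p' X * phi c q' X.
have P_gt0 : 0 < P by rewrite mulr_gt0 ?phi_gt0.
have P_le : P' ^+ c * (p'`! * q'`!)%:R <= theta * (p`! * q`!)%:R * P ^+ c.
  have := ratio_le X.-1; rewrite prednK // -/P -/P' expr_div_n ler_pdivrMr ?exprn_gt0 //.
  move=> /(ler_wpM2r (ler0n _ (p'`! * q'`!))) /le_trans; apply.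
  rewrite mulrAC ler_wpM2r ?exprn_ge0 ?(ltW P_gt0) // -mulrA ler_wpM2l ?T_le //.
  exact: ltW.
have ->: alpha c p' X * alpha c q' X = P' ^+ c / ('C(X, p') * 'C(X, q'))%:R.
  by rewrite /alpha /P' exprMn natrM invfM mulrACA.
have ->: beta c p X * beta c q X = P ^+ c / ('C(X + p, p) * 'C(X + q, q))%:R.
  by rewrite /beta /P exprMn natrM invfM mulrACA.
rewrite ltr_pdivrMr ?natrM ?mulr_gt0 ?bin'_gt0 // mulrAC ltr_pdivlMr ?mulr_gt0 //.
have f_gt0 : 0 < (p`! * q`! * (p'`! * q'`!))%:R :> rat.
  by rewrite ltr0n !muln_gt0 !fact_gt0.
have bin_up : ('C(X + p, p) * 'C(X + q, q) * (p`! * q`!))%:R <= (X + s)%:R ^+ s :> rat.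
  rewrite mulnACA !bin_ffact natrM [in leRHS]/s exprD.
  apply: ler_pM => //; apply: le_trans (natr_ffact_le _ _) _.
    by rewrite lerXn2r ?nnegrE // ler_nat /s; lia.
  by rewrite lerXn2r ?nnegrE // ler_nat /s; lia.
have bin_lo : (X - s)%:R ^+ s <= ('C(X, p') * 'C(X, q') * (p'`! * q'`!))%:R :> rat.
  rewrite mulnACA !bin_ffact natrM {2}/s sumE exprD.
  by apply: ler_pM; rewrite ?exprn_ge0 // natr_ffact_ge // /s sumE ?leq_addr ?leq_addl.
have ratio : theta * (X + s)%:R ^+ s < (X - s)%:R ^+ s :> rat.
  apply: lt_le_trans (shifted_power_ratio le_sX X_gt0).
  by rewrite ltr_pM2r // exprn_gt0.
rewrite -(ltr_pM2r f_gt0) -!natrM.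
have -> : P' ^+ c * ('C(X + p, p) * 'C(X + q, q))%:R * (p`! * q`! * (p'`! * q'`!))%:R
  = P' ^+ c * (p'`! * q'`!)%:R * ('C(X + p, p) * 'C(X + q, q) * (p`! * q`!))%:R.
  by rewrite [(p`! * q`! * _)%N]mulnC [(p'`! * q'`! * _)%:R]natrM mulrACA -natrM.
have -> : P ^+ c * ('C(X, p') * 'C(X, q'))%:R * (p`! * q`! * (p'`! * q'`!))%:R
  = (p`! * q`!)%:R * P ^+ c * ('C(X, p') * 'C(X, q') * (p'`! * q'`!))%:R.
  by rewrite [(p`! * q`! * _)%:R]natrM mulrACA -natrM [_ * P ^+ c]mulrC.
have Pf_gt0 : 0 < (p`! * q`!)%:R * P ^+ c.
  by rewrite mulr_gt0 ?exprn_gt0 // ltr0n muln_gt0 !fact_gt0.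
apply: lt_le_trans (ler_wpM2l (ltW Pf_gt0) bin_lo).
apply: le_lt_trans (_ : (p`! * q`!)%:R * P ^+ c * (theta * (X + s)%:R ^+ s) < _).
  rewrite mulrA [_ * theta]mulrC mulrA; apply: ler_pM => //.
  by rewrite mulr_ge0 ?exprn_ge0 // mulr_ge0 // ltW ?phi_gt0.
by rewrite ltr_pM2l.
Qed.

End Gap.

(** * Products along a spine *)

Section SpineProducts.

Local Open Scope ring_scope.

Lemma prod_ord_pred c (F : nat -> rat) : (0 < c)%N ->
  \prod_(l < c) F l = \prod_(l < c.-1) F l * F c.-1.
Proof. by case: c => // c _; rewrite big_ord_recr. Qed.

(** Only every [c]-th element of the spine carries a weight, but it carries the
    power [c] of [V]. Within a window of [c] steps from [x i] to [x j], the
    hypothesis trades each of the [c - 1] surplus factors [V (x j)] for the [V]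
    of an inner element, at the cost of moving the potential [D] from [x i] to
    [x j]; over successive windows the potentials telescope. *)
Lemma spine_prod_potential (V D : nat -> rat) (x : nat -> nat) (c n : nat) :
    (0 < c)%N -> (forall v, 0 < V v) -> (forall v, 0 < D v) ->
    (forall i j, (i <= j <= c * n)%N ->
       forall k, (i <= k <= j)%N -> V (x j) * D (x i) <= D (x j) * V (x k)) ->
  D (x 0%N) ^+ c.-1 * \prod_(i < n) V (x (c * i.+1)%N) ^+ c <=
  D (x (c * n)%N) ^+ c.-1 * \prod_(k < c * n) V (x k.+1).
Proof.
move=> c_gt0 V_gt0 D_gt0 VD; elim: n VD => [|n IHn] VD.
  by rewrite muln0 !big_ord0.
have V_ge0 v : 0 <= V v by apply: ltW.
have D_ge0 v : 0 <= D v by apply: ltW.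
have {}IHn : D (x 0%N) ^+ c.-1 * \prod_(i < n) V (x (c * i.+1)%N) ^+ c <=
    D (x (c * n)%N) ^+ c.-1 * \prod_(k < c * n) V (x k.+1).
  apply: IHn => i j /andP[le_ij le_j]; apply: VD.
  by rewrite le_ij (leq_trans le_j) // leq_pmul2l.
have window k : (k <= c.-1)%N ->
    V (x (c * n.+1)%N) ^+ k * D (x (c * n)%N) ^+ k <=
    D (x (c * n.+1)%N) ^+ k * \prod_(l < k) V (x (c * n + l).+1).
  elim: k => [|k IHk] lt_k; first by rewrite big_ord0.
  rewrite big_ord_recr !exprSr /= mulrACA [leRHS]mulrACA.
  apply: ler_pM; [by rewrite mulr_ge0 ?exprn_ge0 | by rewrite mulr_ge0 | |].
    by apply: IHk; apply: ltnW.
  apply: VD; first by rewrite leqnn leq_pmul2l ?leqnSn.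
  rewrite leqW ?leq_addr //= mulnSr -addnS leq_add2l.
  by apply: leq_trans lt_k (leq_pred _).
rewrite big_ord_recr /= mulrA.
apply: le_trans (ler_wpM2r (exprn_ge0 _ (V_ge0 _)) IHn) _.
have -> : \prod_(k < c * n.+1) V (x k.+1) = \prod_(k < c * n) V (x k.+1) *
    (\prod_(l < c.-1) V (x (c * n + l).+1) * V (x (c * n.+1)%N)).
  rewrite [in LHS]mulnSr big_split_ord /=; congr (_ * _).
  rewrite (@prod_ord_pred c (fun l => V (x (c * n + l).+1)) c_gt0).
  by rewrite -addnS prednK // -mulnSr.
rewrite -[c in V _ ^+ c](prednK c_gt0) exprSr.
have := window _ (leqnn c.-1).
set z := x (c * n.+1)%N; set y := x (c * n)%N.
set A := \prod_(k < c * n) _; set B := \prod_(k < c.-1) _ => w.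
rewrite (_ : _ * _ * _ = (A * V z) * (V z ^+ c.-1 * D y ^+ c.-1)); last by ring.
rewrite (_ : D z ^+ c.-1 * _ = (A * V z) * (D z ^+ c.-1 * B)); last by ring.
by rewrite ler_wpM2l // mulr_ge0 // prodr_ge0.
Qed.

(** For unimodal [V] the running maximum [V (minn v mu)] is a potential for [V],
    and the reciprocal of [V (maxn v mu)] is one for the reciprocal of [V]. *)
Lemma unimodal_spine_prod (V : nat -> rat) (mu : nat) (M c n : nat) (B : rat)
    (x : nat -> nat) :
    (0 < c)%N -> (mu <= M)%N ->
    (forall v, 0 < V v) -> (forall v, (v <= M)%N -> 1 <= V v <= B) ->
    (forall u v, (u <= v <= mu)%N -> V u <= V v) ->
    (forall u v, (mu <= u <= v)%N -> (v <= M)%N -> V v <= V u) ->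
    (forall k, (k <= c * n)%N -> x k <= M)%N ->
    (forall k l, (k <= l <= c * n)%N -> x k <= x l)%N ->
  \prod_(i < n) V (x (c * i.+1)%N) ^+ c <= B ^+ c.-1 * \prod_(k < c * n) V (x k.+1) /\
  \prod_(k < c * n) V (x k.+1) <= B ^+ c.-1 * \prod_(i < n) V (x (c * i.+1)%N) ^+ c.
Proof.
move=> c_gt0 le_muM V_gt0 VB V_incr V_decr x_le x_mono.
have V_ge0 v : 0 <= V v by apply: ltW.
have lo_le v : (v <= M)%N -> (minn v mu <= M)%N by rewrite geq_min => ->.
have hi_le v : (v <= M)%N -> (maxn v mu <= M)%N by rewrite geq_max => ->.
have pow1 v k : (v <= M)%N -> 1 <= V v ^+ k <= B ^+ k.
  move=> /VB/andP[V_ge1 V_leB]; rewrite exprn_ege1 //= lerXn2r ?nnegrE //.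
  exact: le_trans (V_leB).
split.
  have := @spine_prod_potential V (fun v => V (minn v mu)) x c n c_gt0 V_gt0.
  move=> /(_ (fun v => V_gt0 _)) H.
  have {H} /H H : forall i j, (i <= j <= c * n)%N -> forall k, (i <= k <= j)%N ->
      V (x j) * V (minn (x i) mu) <= V (minn (x j) mu) * V (x k).
    move=> i j /andP[le_ij le_j] k /andP[le_ik le_kj].
    have le_xik : (x i <= x k)%N by apply: x_mono; rewrite le_ik (leq_trans le_kj).
    have le_xkj : (x k <= x j)%N by apply: x_mono; rewrite le_kj.
    have le_xjM : (x j <= M)%N by apply: x_le.
    have [le_kmu | lt_muk] := leqP (x k) mu.
      apply: ler_pM => //.
        have [le_jmu | lt_muj] := leqP (x j) mu; first by [].
        by rewrite V_decr // leqnn ltnW.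
      by rewrite (minn_idPl (leq_trans le_xik le_kmu)) V_incr ?le_xik.
    rewrite mulrC; apply: ler_pM => //; last by rewrite V_decr // ltnW.
    by rewrite (minn_idPr (ltnW (leq_trans lt_muk le_xkj))) V_incr // geq_minr leqnn.
  have x0 : (x 0%N <= M)%N by apply: x_le.
  have xn : (x (c * n)%N <= M)%N by apply: x_le.
  have /andP[D0 _] := pow1 _ c.-1 (lo_le _ x0).
  have /andP[_ Dn] := pow1 _ c.-1 (lo_le _ xn).
  apply: le_trans (_ : _ <= V (minn (x 0%N) mu) ^+ c.-1 * _) _.
    by apply: ler_peMl D0; apply: prodr_ge0 => i _; apply: exprn_ge0.
  apply: le_trans H _; apply: ler_wpM2r Dn; exact: prodr_ge0.
have Vi_gt0 v : 0 < (V v)^-1 by rewrite invr_gt0.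
have := @spine_prod_potential (fun v => (V v)^-1) (fun v => (V (maxn v mu))^-1) x c n.
move=> /(_ c_gt0 Vi_gt0 (fun v => Vi_gt0 _)) H.
have {H} /H H : forall i j, (i <= j <= c * n)%N -> forall k, (i <= k <= j)%N ->
    (V (x j))^-1 * (V (maxn (x i) mu))^-1 <= (V (maxn (x j) mu))^-1 * (V (x k))^-1.
  move=> i j /andP[le_ij le_j] k /andP[le_ik le_kj].
  have le_xik : (x i <= x k)%N by apply: x_mono; rewrite le_ik (leq_trans le_kj).
  have le_xkj : (x k <= x j)%N by apply: x_mono; rewrite le_kj.
  have le_xjM : (x j <= M)%N by apply: x_le.
  have le_xkM := leq_trans le_xkj le_xjM.
  rewrite -!invfM lef_pV2 ?posrE ?mulr_gt0 //.
  have [le_jmu | lt_muj] := leqP (x j) mu.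
    have le_imu := leq_trans (leq_trans le_xik le_xkj) le_jmu.
    rewrite (maxn_idPr le_imu) mulrC ler_wpM2r //.
    by rewrite V_incr ?le_xkj.
  rewrite ler_wpM2l //.
  have [le_kmu | lt_muk] := leqP (x k) mu.
    by rewrite (maxn_idPr (leq_trans le_xik le_kmu)) V_incr ?le_kmu ?leqnn.
  rewrite V_decr // leq_maxr geq_max le_xik ltnW //.
have x0 : (x 0%N <= M)%N by apply: x_le.
have xn : (x (c * n)%N <= M)%N by apply: x_le.
have /andP[_ D0] := pow1 _ c.-1 (hi_le _ x0).
have /andP[Dn _] := pow1 _ c.-1 (hi_le _ xn).
set L := \prod_(k < _) _; set R := \prod_(i < _) _.
have L_gt0 : 0 < L by apply: prodr_gt0.
have R_gt0 : 0 < R by apply: prodr_gt0 => i _; apply: exprn_gt0.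
move: H; under eq_bigr do rewrite exprVn; rewrite !exprVn !prodfV -/L -/R -!invfM.
rewrite lef_pV2 ?posrE ?mulr_gt0 ?exprn_gt0 // => H.
apply: le_trans (_ : _ <= V (maxn (x (c * n)%N) mu) ^+ c.-1 * L) _.
  by apply: ler_peMl Dn; apply: ltW.
by apply: le_trans H _; apply: ler_wpM2r D0; apply: ltW.
Qed.

End SpineProducts.

(** * Bounds on the number of linear extensions of a cluster poset *)

Section ClusterBounds.

Local Open Scope ring_scope.

Variables n p c q M : nat.
Hypotheses (c_gt0 : (0 < c)%N) (q_gt0 : (0 < q)%N).

Local Notation m := (p + c + q).+1.
Local Notation poset := (cluster n.+1 m p.+1 (p + c).+1).
Local Notation K := (c * n.+1).+1.
Local Notation phi := (phi c).
Local Notation V := (fun v => phi p v * phi q (M - v)).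
Local Notation B := (M.+1%:R ^+ (p + q) : rat).
Local Notation U := (phi (p + q + c) M).
Local Notation N := #|{: poset}|.

Let V_gt0 v : 0 < V v.
Proof. by rewrite mulr_gt0 ?phi_gt0. Qed.

Let phi_ge0 r v : 0 <= phi r v.
Proof. by apply/ltW/phi_gt0. Qed.

Let V_bounds v : (v <= M)%N -> 1 <= V v <= B.
Proof.
move=> le_vM; apply/andP; split.
  by rewrite -[1]mulr1; apply: ler_pM => //; apply: phi_ge1.
rewrite exprD; apply: ler_pM => //; apply: le_trans (phi_ub c_gt0 _ _) _.
  by rewrite lerXn2r ?nnegrE // ler_nat.
by rewrite lerXn2r ?nnegrE // ler_nat ltnS leq_subr.
Qed.

Let phi_le_B v : (v <= M)%N -> phi p v <= B.
Proof.
move=> le_vM; have /andP[_] := V_bounds le_vM; apply: le_trans.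
by rewrite ler_peMr // phi_ge1.
Qed.

Let B_ge1 : 1 <= B.
Proof. by rewrite exprn_ege1 // ler1n. Qed.

(** In the weight of a spine the two factors of [V] sit at opposite ends of each
    chain; shifting one of them by a chain affects only the two extreme ends,
    and thus costs a power of [M + 1], as does passing from every [c]-th spine
    element to all of them. *)
Lemma spine_weight_bounds (x : {ffun 'I_K -> 'I_M.+1}) : x \in weak_maps 'I_K M.+1 ->
  let W := \prod_(i < n.+1) (phi p (x (inord (c * i))) ^+ c *
                             phi q (M - x (inord (c * i + c))) ^+ c) in
  W <= B ^+ (2 * c) * \prod_k V (x k) /\ \prod_k V (x k) <= B ^+ (2 * c) * W.
Proof.
move=> /weak_maps_ordP x_le W; pose xn k : nat := x (inord k).
have xn_le k : (xn k <= M)%N by rewrite -ltnS; apply: ltn_ord.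
pose f i := phi p (xn (c * i)%N) ^+ c; pose g i := phi q (M - xn (c * i.+1)%N) ^+ c.
have B_ge0 : 0 <= B by apply: le_trans B_ge1.
have f_bounds i : 1 <= f i <= B ^+ c.
  rewrite exprn_ege1 ?phi_ge1 //=; apply: lerXn2r; rewrite ?nnegrE //.
  exact: phi_le_B.
have f_ge0 i : 0 <= f i by apply: exprn_ge0.
have g_ge0 i : 0 <= g i by apply: exprn_ge0.
pose W1 := \prod_(i < n.+1) V (xn (c * i.+1)%N) ^+ c.
have WE : W = \prod_(i < n.+1) f i * \prod_(i < n.+1) g i.
  by rewrite -big_split; apply: eq_bigr => i _; rewrite /f /g [(c * i.+1)%N]mulnSr.
have W1E : W1 = \prod_(i < n.+1) f i.+1 * \prod_(i < n.+1) g i.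
  by rewrite -big_split; apply: eq_bigr => i _; rewrite exprMn.
have shift : W * f n.+1 = f 0%N * W1.
  rewrite WE W1E mulrAC mulrA; congr (_ * _).
  by rewrite -(big_ord_recr n.+1 (fun i => f i)) /= big_ord_recl.
have W_ge0 : 0 <= W by rewrite WE mulr_ge0 // prodr_ge0.
have W1_ge0 : 0 <= W1 by rewrite W1E mulr_ge0 // prodr_ge0.
have W_le : W <= B ^+ c * W1.
  have /andP[fn _] := f_bounds n.+1; have /andP[_ f0] := f_bounds 0%N.
  by apply: le_trans (ler_wpM2r W1_ge0 f0); rewrite -shift ler_peMr.
have W1_le : W1 <= B ^+ c * W.
  have /andP[_ fn] := f_bounds n.+1; have /andP[f0 _] := f_bounds 0%N.
  by apply: le_trans (ler_wpM2r W_ge0 fn); rewrite [leRHS]mulrC shift ler_peMl.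
have [mu [le_muM V_incr V_decr]] := phi_convolution_mode c_gt0 p M q_gt0.
have [le1 le2] : W1 <= B ^+ c.-1 * \prod_(k < c * n.+1) V (xn k.+1) /\
  \prod_(k < c * n.+1) V (xn k.+1) <= B ^+ c.-1 * W1.
  apply: (unimodal_spine_prod c_gt0 le_muM) => //.
  move=> k l /andP[le_kl le_l]; apply: x_le.
  by rewrite !inordK // ltnS (leq_trans le_kl).
have P0E : \prod_k V (x k) = V (xn 0%N) * \prod_(k < c * n.+1) V (xn k.+1).
  rewrite big_ord_recl; congr (_ * _).
    by rewrite /xn; congr (V (x _)); apply: val_inj; rewrite /= inordK.
  apply: eq_bigr => k _; rewrite /xn; have -> // : inord k.+1 = lift ord0 k.
  by apply: val_inj; rewrite /= inordK // ltnS ltn_ord.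
have P1_ge0 : 0 <= \prod_(k < c * n.+1) V (xn k.+1).
  by apply: prodr_ge0 => k _; apply: ltW.
have /andP[V0_ge1 V0_le] := V_bounds (xn_le 0%N).
have Bpow : B ^+ (2 * c) = B * B ^+ c.-1 * B ^+ c.
  by rewrite -exprS prednK // -exprD addnn mul2n.
rewrite P0E Bpow; move: V0_ge1 V0_le P1_ge0 le1 le2.
move: (V (xn 0%N)) (\prod_(k < c * n.+1) _) => V0 P1 V0_ge1 V0_le P1_ge0 le1 le2.
have V0P1_ge0 : 0 <= V0 * P1 by rewrite mulr_ge0 // (le_trans _ V0_ge1).
split.
  apply: le_trans W_le _; rewrite [_ * B ^+ c]mulrC -!mulrA.
  apply: ler_wpM2l; first exact: exprn_ge0.
  apply: le_trans le1 _; rewrite mulrCA; apply: ler_wpM2l; first exact: exprn_ge0.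
  by apply: le_trans (ler_peMl P1_ge0 V0_ge1) _; apply: ler_peMl.
apply: le_trans (ler_wpM2r P1_ge0 V0_le) _; rewrite -!mulrA; apply: ler_wpM2l => //.
apply: le_trans le2 _; apply: ler_wpM2l => //; exact: exprn_ge0.
Qed.

Let sum_V : \sum_(v < M.+1) V v = U.
Proof. exact: sum_phi. Qed.

Let V_ord_ge0 (v : 'I_M.+1) : 0 <= V v.
Proof. exact: ltW. Qed.

Lemma cluster_upper_bound X :
  (num_linear_extensions poset * 'C(M.+1, N))%:R *
    (beta c p X * beta c q X) ^+ n.+1 * K`!%:R <= B ^+ (2 * c) * U ^+ K.
Proof.
set be := beta c p X * beta c q X.
have beta_ge0 r : 0 <= beta c r X by apply/ltW/beta_gt0.
have be_ge0 : 0 <= be by rewrite mulr_ge0.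
have B_ge0 : 0 <= B ^+ (2 * c) by rewrite !exprn_ge0.
have le_count := leq_trans (num_linear_extensions_le_strict poset M.+1)
  (card_strict_maps_cluster n p q c_gt0 M).
apply: le_trans (_ : _ <= B ^+ (2 * c) *
    (K`!%:R * \sum_(x in strict_maps 'I_K M.+1) \prod_k V (x k))) _; last first.
  rewrite ler_wpM2l // -sum_V; exact: sum_strict_maps_le.
rewrite [leRHS]mulrCA [leLHS]mulrC ler_wpM2l //.
move: le_count; rewrite -(ler_nat rat) => le_count.
apply: le_trans (ler_wpM2r (exprn_ge0 _ be_ge0) le_count) _.
rewrite natr_sum mulr_suml mulr_sumr; apply: ler_sum => x x_strict.
have x_weak : x \in weak_maps 'I_K M.+1.
  apply/weak_maps_ordP => i j; rewrite leq_eqVlt => /predU1P[/val_inj-> //|].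
  by move/(strict_maps_ordP _ x_strict)/ltnW.
have [W_le _] := spine_weight_bounds x_weak; apply: le_trans W_le.
rewrite natr_prod -[n.+1 in X in _ * X <= _]card_ord -prodr_const -big_split /=.
apply: ler_prod => i _; rewrite mulr_ge0 //=.
have := card_strict_rows p q c_gt0 x i; rewrite -(ler_nat rat) natrM.
move=> /(ler_wpM2r be_ge0)/le_trans; apply; rewrite /be mulrACA.
by apply: ler_pM; [apply: mulr_ge0 | apply: mulr_ge0 | |]; rewrite // strict_weight.
Qed.

Lemma cluster_lower_bound X : (p <= X)%N -> (q <= X)%N ->
  U ^+ K <= B ^+ (2 * c) * (num_linear_extensions poset * 'C(M + N, N))%:R *
    (alpha c p X * alpha c q X) ^+ n.+1 * K`!%:R.
Proof.
move=> le_pX le_qX; set al := alpha c p X * alpha c q X.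
have al_ge0 : 0 <= al by rewrite mulr_ge0 // divr_ge0 ?exprn_ge0.
have B_ge0 : 0 <= B ^+ (2 * c) by rewrite !exprn_ge0.
have le_count := leq_trans (card_weak_maps_cluster n p q c_gt0 M)
  (weak_le_num_linear_extensions poset M).
apply: le_trans (_ : B ^+ (2 * c) * 
    (K`!%:R * \sum_(x in weak_maps 'I_K M.+1)
      B ^- (2 * c) * \prod_k V (x k)) <= _).
  rewrite -mulr_sumr mulrCA mulVKf; last first.
    by rewrite expf_neq0 // gt_eqF // (lt_le_trans _ B_ge1).
  by rewrite -sum_V; apply: sum_weak_maps_ge.
rewrite -!mulrA ler_wpM2l // mulrC mulrA ler_wpM2r //.
move: le_count; rewrite -(ler_nat rat) => le_count.
apply: le_trans (ler_wpM2r (exprn_ge0 _ al_ge0) le_count).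
rewrite natr_sum mulr_suml; apply: ler_sum => x x_weak.
have [_ W_ge] := spine_weight_bounds x_weak.
rewrite ler_pdivrMl; last by rewrite !exprn_gt0 // (lt_le_trans _ B_ge1).
apply: le_trans W_ge _; rewrite ler_wpM2l //.
rewrite natr_prod -[n.+1 in X in _ <= _ * X]card_ord -prodr_const -big_split /=.
apply: ler_prod => i _; rewrite mulr_ge0 ?exprn_ge0 //=.
have := card_weak_rows p q c_gt0 i x_weak; rewrite -(ler_nat rat) natrM.
move=> /(ler_wpM2r al_ge0); apply: le_trans; rewrite /al mulrACA.
by apply: ler_pM; rewrite ?exprn_ge0 ?weak_weight.
Qed.

End ClusterBounds.

(** * Comparison of the two posets *)

Section Comparison.

Local Open Scope ring_scope.

(** Corresponding factors of the two falling factorials differ by a relative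
    amount of order [1 / N], and there are [N] of them. *)
Lemma bin_ratio_le N : (0 < N)%N ->
  ('C(4 * N ^ 2 + N, N) <= 2 * 'C((4 * N ^ 2).+1, N))%N.
Proof.
move=> N_gt0; set M := (4 * N ^ 2)%N.
have le_NM : (N <= M)%N by rewrite /M; nia.
have M_gt0 : (0 < M)%N by apply: leq_trans le_NM.
rewrite -(@leq_pmul2r N`!) ?fact_gt0 // -mulnA !bin_ffact -(ler_nat rat) natrM.
apply: le_trans (natr_ffact_le _ _) _.
apply: le_trans (ler_wpM2l _ (natr_ffact_ge _ (leqnn N))) => //.
apply: le_trans (_ : 2%:R * (M - N)%:R ^+ N <= _); last first.
  rewrite ler_wpM2l // lerXn2r ?nnegrE // ler_nat leq_sub2r //.
have := shifted_power_ratio le_NM M_gt0; have MN_gt0 : 0 < (M + N)%:R :> rat.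
  by rewrite ltr0n addn_gt0 M_gt0.
have half : (2 * N ^ 2)%:R / (M + N)%:R <= 1 / 2%:R :> rat.
  rewrite ler_pdivrMr // mul1r mulrC ler_pdivlMr // -natrM ler_nat /M; lia.
set t := _ / _ in half *; have : 0 <= (M + N)%:R ^+ N :> rat by rewrite exprn_ge0.
by move: (_ ^+ N) (_ ^+ N) => Y Z; nra.
Qed.

(** The upper bound for the first poset and the lower bound for the second contain
    the same power of [U], as [p + q = p' + q']; there remains a factor [be / al]
    per chain, against powers of [M], which are polynomial in [n]. *)
Lemma num_linear_extensions_cluster_lt (p c q p' q' : nat) :
  (1 < c)%N -> (p < p')%N -> (p' <= q')%N -> (p + q = p' + q')%N ->
  exists N, forall n, (N <= n)%N ->
    (num_linear_extensions (cluster n (p + c + q).+1 p.+1 (p + c).+1) <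
     num_linear_extensions (cluster n (p' + c + q').+1 p'.+1 (p' + c).+1))%N.
Proof.
move=> c_gt1 lt_pp' le_pq' sumE; have c_gt0 := ltnW c_gt1.
have q_gt0 : (0 < q)%N by lia.
have q'_gt0 : (0 < q')%N by lia.
have [X [le_p'X le_q'X gap]] := alpha_beta_gap c_gt1 le_pq' lt_pp' sumE.
set al := alpha c p' X * alpha c q' X in gap.
set be := beta c p X * beta c q X in gap.
have al_gt0 : 0 < al.
  by rewrite mulr_gt0 // divr_gt0 ?exprn_gt0 ?phi_gt0 // ltr0n bin_gt0.
have be_gt0 := lt_trans al_gt0 gap.
have theta_gt1 : 1 < be / al by rewrite ltr_pdivlMr // mul1r.
pose m := (p + c + q).+1; pose s := (p + q)%N; pose d := (2 * c + 2 * c)%N.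
have mE : (p' + c + q').+1 = m by rewrite /m; lia.
pose A : rat := 2%:R * ((5 * m ^ 2)%:R ^+ s) ^+ d.
have [n0 n0P] := exponential_beats_polynomial A (2 * s * d) theta_gt1.
exists n0.+1 => -[//|n] lt_n.
set P := cluster _ _ _ _; set P' := cluster _ _ _ _.
have cardP : #|{: P}| = (n.+1 * m - n)%N := card_cluster n p q c_gt0.
have cardP' : #|{: P'}| = (n.+1 * m - n)%N.
  by rewrite (card_cluster n p' q' c_gt0) mE.
set N := (n.+1 * m - n)%N in cardP cardP'.
have N_gt0 : (0 < N)%N by rewrite /N /m; nia.
pose M := (4 * N ^ 2)%N; pose B : rat := M.+1%:R ^+ s; pose K := (c * n.+1).+1.
have := cluster_upper_bound n p M c_gt0 q_gt0 X.
have := cluster_lower_bound n M c_gt0 q'_gt0 le_p'X le_q'X.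
rewrite -/P -/P' cardP cardP' -sumE -/s -/B -/be -/al -/K.
set U := phi _ _ _; set e := num_linear_extensions P.
set e' := num_linear_extensions P'; set bu := 'C(_, _); set bl := 'C(_, _).
move=> U_le le_U.
have U_gt0 : 0 < U ^+ K by rewrite exprn_gt0 ?phi_gt0.
have bl_gt0 : (0 < bl)%N by rewrite bin_gt0 /M; nia.
have bu_le : (bu <= 2 * bl)%N by apply: bin_ratio_le.
have B_ge0 : 0 <= B by rewrite exprn_ge0.
have K_gt0 : 0 < K`!%:R :> rat by rewrite ltr0n fact_gt0.
have e'_gt0 : (0 < e')%N.
  rewrite lt0n; apply: contraTneq U_le => e'0.
  by rewrite e'0 mul0n mulr0 !mul0r -ltNge.
have poly : 2%:R * B ^+ d <= A * n.+1%:R ^+ (2 * s * d).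
  rewrite /A /B -mulrA ler_wpM2l // -!exprM -(mulnA 2) [_ ^+ (2 * _)]exprM -exprMn.
  rewrite lerXn2r ?nnegrE ?mulr_ge0 ?exprn_ge0 // -natrX -natrM ler_nat /M.
  have : (N <= n.+1 * m)%N by rewrite /N leq_subr.
  have : (0 < n.+1 * m)%N by rewrite muln_gt0.
  by rewrite -mulnA -expnMn [(m * _)%N]mulnC; nia.
have be_pow : be ^+ n.+1 = (be / al) ^+ n.+1 * al ^+ n.+1.
  by rewrite -exprMn divfK // gt_eqF.
have e_le : e%:R * be ^+ n.+1 <= 2%:R * B ^+ d * (e'%:R * al ^+ n.+1).
  have bl_gt0r : 0 < bl%:R :> rat by rewrite ltr0n.
  rewrite -(ler_pM2r bl_gt0r) -(ler_pM2r K_gt0).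
  have -> : e%:R * be ^+ n.+1 * bl%:R * K`!%:R = (e * bl)%:R * be ^+ n.+1 * K`!%:R.
    by rewrite natrM; ring.
  apply: le_trans le_U _; apply: le_trans (ler_wpM2l (exprn_ge0 _ B_ge0) U_le) _.
  have -> : B ^+ (2 * c) * (B ^+ (2 * c) * (e' * bu)%:R * al ^+ n.+1 * K`!%:R) =
    B ^+ d * (e'%:R * al ^+ n.+1) * K`!%:R * bu%:R.
    by rewrite /d exprD natrM; ring.
  have -> : 2%:R * B ^+ d * (e'%:R * al ^+ n.+1) * bl%:R * K`!%:R =
    B ^+ d * (e'%:R * al ^+ n.+1) * K`!%:R * (2 * bl)%:R.
    by rewrite natrM; ring.
  apply: ler_wpM2l; last by rewrite ler_nat.
  by rewrite !mulr_ge0 ?exprn_ge0 // ltW.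
rewrite -(ltr_nat rat) -(ltr_pM2r (exprn_gt0 n.+1 be_gt0)).
apply: le_lt_trans e_le _; rewrite be_pow [ltRHS]mulrCA ltr_pM2r.
  by apply: le_lt_trans poly _; apply: n0P; apply: ltnW.
by rewrite mulr_gt0 ?exprn_gt0 // ltr0n.
Qed.

End Comparison.

Theorem corollary1p5 (m a b a' b' : nat) :
  1 <= a -> a < b -> b <= m ->
  1 <= a' -> a' < b' -> b' <= m ->
  b - a = b' - a' -> 1 < b - a ->
  a + b < a' + b' -> a' + b' <= m + 1 ->
  exists N : nat, forall n : nat, N <= n ->
    num_linear_extensions (cluster n m a b) <
    num_linear_extensions (cluster n m a' b').
Proof.
move=> a_gt0 lt_ab le_bm a'_gt0 lt_ab' le_bm' eq_c c_gt1 lt_sum le_sum.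
have := @num_linear_extensions_cluster_lt a.-1 (b - a) (m - b) a'.-1 (m - b').
have -> : (a.-1 + (b - a) + (m - b)).+1 = m by lia.
have -> : (a'.-1 + (b - a) + (m - b')).+1 = m by lia.
have -> : (a.-1 + (b - a)).+1 = b by lia.
have -> : (a'.-1 + (b - a)).+1 = b' by lia.
rewrite !prednK //; apply; lia.
Qed.
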